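(* Let $k$ be a field and let $k[\Lambda]$ and $k[\Gamma]$ be Koszul affine semigroup rings, where $\Lambda\subseteq\mathbb{N}^d$ and $\Gamma\subseteq\mathbb{N}^e$ are homogeneous affine semigroups. Let $k[\Lambda]_i$ and $k[\Gamma]_i$ denote their $i$-th graded components and set $\mathfrak{m}_\Lambda=\bigoplus_{i\ge 1}k[\Lambda]_i$. Then the $k$-algebra $$k[\Lambda]*k[\Gamma]=\bigoplus_{i\ge 0}\mathfrak{m}_\Lambda^i\otimes_k k[\Gamma]_i$$ is Koszul.
   Context: $\mathbb{N}=\{0,1,2,\ldots\}$. An affine semigroup $\Lambda\subseteq\mathbb{N}^d$ is a finitely generated additive sub-semigroup containing $0$; it is assumed that the elements of $\Lambda$ span $\mathbb{R}^d$ as a vector space (and likewise $\Gamma$ spans $\mathbb{R}^e$). The semigroup ring $k[\Lambda]$ is the subalgebra of $k[x_1,\ldots,x_d]$ generated by all monomials $x_1^{\lambda_1}\cdots x_d^{\lambda_d}$ with $(\lambda_1,\ldots,\lambda_d)\in\Lambda$. $\Lambda$ is homogeneous if all elements of a minimal generating set of $\Lambda$ lie on an affine hyperplane; then $k[\Lambda]$ is a standard graded $k$-algebra with the minimal generators in degree $1$, and $k[\Lambda]_i$ refers to this grading. A $k$-algebra $A$ is standard graded if $A=\bigoplus_{i\in\mathbb{N}}A_i$ as a $k$-vector space, $A_0=k$, $A_iA_j\subseteq A_{i+j}$, and $A$ is generated as an algebra by $A_1$. A standard graded $k$-algebra $A$ is Koszul if $k$ has a linear resolution over $A$, equivalently $\operatorname{Tor}_i^A(k,k)_j=0$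 for all $i\ne j$. In $k[\Lambda]*k[\Gamma]$, $\mathfrak{m}_\Lambda^0=k[\Lambda]$; it is regarded as a subalgebra of $k[\Lambda]\otimes_k k[\Gamma]$. It is the semigroup ring of the affine semigroup generated by all $(\lambda,0)$ and $(\lambda,\gamma)$ with $\lambda\in\Lambda$ and $\gamma\in\Gamma$ of degree $1$, and is standard graded with these generators in degree $1$ (that is, $k[\Lambda]_j\otimes_k k[\Gamma]_i$ with $j\ge i$ has degree $j$). *)

(* Defs.v *)
From HB Require Import structures.
From mathcomp Require Import all_boot all_order all_algebra.
From mathcomp Require Export mpoly.
From mathcomp Require Export classical_sets reals.

Set Implicit Arguments.
Unset Strict Implicit.
Unset Printing Implicit Defensive.

Import GRing.Theory.
Local Open Scope ring_scope.
Local Open Scope classical_set_scope.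

(* Subspaces, subalgebras and ideals are [set S], inside an ambient k-algebra
   [S]; a grading of a subalgebra is the family of its components. *)
Section GradedAlgebra.
Variables (k : fieldType) (S : algType k).
Implicit Types (A B V W I J : set S) (gr : nat -> set S).

Definition is_subspace V : Prop :=
  V 0 /\ forall (c : k) u v, V u -> V v -> V (c *: u + v).

Definition is_subalgebra B : Prop :=
  [/\ is_subspace B, B 1 & forall u v, B u -> B v -> B (u * v)].

Definition lin_span (P : set S) : set S :=
  [set f | forall V, is_subspace V -> P `<=` V -> V f].

Definition alg_gen (P : set S) : set S :=
  [set f | forall B, is_subalgebra B -> P `<=` B -> B f].

Definition sum_of gr : set S :=
  [set f | exists n (g : nat -> S),
     (forall i, gr i (g i)) /\ f = \sum_(i < n) g i].

Definition independent gr : Prop :=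
  forall n (g : nat -> S), (forall i, gr i (g i)) ->
    \sum_(i < n) g i = 0 -> forall i, (i < n)%N -> g i = 0.

Record standard_graded A gr : Prop := StandardGraded {
  sg_subspace : forall i, is_subspace (gr i);
  sg_sum : A = sum_of gr;
  sg_direct : independent gr;
  sg_gr0 : gr 0%N = [set c%:A | c in [set: k]];
  sg_mul : forall i j f g, gr i f -> gr j g -> gr (i + j)%N (f * g);
  sg_gen : A = alg_gen (gr 1%N)
}.

(* The ideal \bigoplus_(i >= 1) A_i. *)
Definition irrelevant_ideal gr : set S := sum_of (fun i => gr i.+1).

Definition ideal_mul I J : set S :=
  [set f | exists n (g h : 'I_n -> S),
     [/\ forall i, I (g i), forall i, J (h i) & f = \sum_(i < n) g i * h i]].

Definition ideal_exp A I (i : nat) : set S := iter i (ideal_mul I) A.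

(* A linear resolution of k = A / A_+ over A is an exact complex of graded
   A-modules
     ... -> A(-2)^(b 1) -> A(-1)^(b 0) -> A -> k -> 0
   with differentials of degree 0 and A -> k the canonical projection.  Free
   modules are modules of row vectors with entries in A, with the
   differentials acting by right multiplication; a map
   A(-i-1)^p -> A(-i)^q is of degree 0 exactly when the entries of its matrix
   lie in A_1.  Ranks are finite, as they must be when A is Noetherian. *)
Definition res_rank (b : nat -> nat) (i : nat) : nat :=
  if i is j.+1 then b j else 1%N.

Definition row_over A n (u : 'rV[S]_n) : Prop := forall j, A (u 0 j).

Definition linear_resolution A gr (b : nat -> nat)
    (M : forall i, 'M[S]_(res_rank b i.+1, res_rank b i)) : Prop :=
  [/\ forall i r c, gr 1%N (M i r c),
      forall u : 'rV[S]_1,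
        irrelevant_ideal gr (u 0 0) <->
        exists2 v : 'rV[S]_(res_rank b 1), row_over A v & u = v *m M 0%N
    & forall i (u : 'rV[S]_(res_rank b i.+1)), row_over A u ->
        (u *m M i = 0 <->
         exists2 v : 'rV[S]_(res_rank b i.+2),
           row_over A v & u = v *m M i.+1)].

Definition koszul A gr : Prop :=
  standard_graded A gr /\ exists b M, @linear_resolution A gr b M.

End GradedAlgebra.

Section AffineSemigroup.
Variable n : nat.
Implicit Types (L G H : set 'X_{1..n}).

(* [semigroup_sum G i m]: m is a sum of i elements of G. *)
Definition semigroup_sum G (i : nat) (m : 'X_{1..n}) : Prop :=
  exists s : seq 'X_{1..n},
    [/\ size s = i, forall x, x \in s -> G x & m = (\sum_(x <- s) x)%MM].

(* The empty sum is allowed, so that 0 is always in the generated semigroup. *)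
Definition semigroup_gen G : set 'X_{1..n} :=
  [set m | exists i, semigroup_sum G i m].

Definition spans_space (R : realType) L : Prop :=
  forall v : 'rV[R]_n, exists p (c : 'I_p -> R) (m : 'I_p -> 'X_{1..n}),
    (forall j, L (m j)) /\
    v = \sum_(j < p) c j *: \row_(i < n) (m j i)%:R.

Definition affine_semigroup (R : realType) L : Prop :=
  (exists s : seq 'X_{1..n}, L = semigroup_gen [set` s]) /\ spans_space R L.

Definition minimal_generating_set L G : Prop :=
  L = semigroup_gen G /\
  forall H, H `<=` G -> L = semigroup_gen H -> H = G.

Definition on_affine_hyperplane (R : realType) G : Prop :=
  exists (a : 'rV[R]_n) (c : R), a != 0 /\
    forall m, G m -> \sum_(i < n) a 0 i * (m i)%:R = c.

Definition homogeneous (R : realType) L : Prop :=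
  exists2 G, minimal_generating_set L G & on_affine_hyperplane R G.

(* The elements of degree i, the minimal generators having degree 1; an affine
   semigroup in N^n has exactly one minimal generating set. *)
Definition semigroup_degree L (i : nat) : set 'X_{1..n} :=
  [set m | exists2 G, minimal_generating_set L G & semigroup_sum G i m].

Variable k : fieldType.

Definition semigroup_ring L : set {mpoly k[n]} :=
  alg_gen [set 'X_[m] | m in L].

Definition semigroup_ring_gr L (i : nat) : set {mpoly k[n]} :=
  lin_span [set 'X_[m] | m in semigroup_degree L i].

End AffineSemigroup.

Arguments semigroup_ring {n} k L.
Arguments semigroup_ring_gr {n} k L i.

Section ReesProduct.
Variables (k : fieldType) (d e : nat).

Definition inj_left (f : {mpoly k[d]}) : {mpoly k[d + e]} :=
  f \mPo [tuple 'X_(lshift e i) | i < d].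

Definition inj_right (g : {mpoly k[e]}) : {mpoly k[d + e]} :=
  g \mPo [tuple 'X_(rshift d i) | i < e].

(* For subspaces V of k[x_1..x_d] and W of k[y_1..y_e], the image of
   V (x)_k W under the isomorphism f (x) g |-> f(x) g(y) from
   k[x] (x)_k k[y] to k[x, y]. *)
Definition tensor (V : set {mpoly k[d]}) (W : set {mpoly k[e]}) :
    set {mpoly k[d + e]} :=
  lin_span [set inj_left f * inj_right g | f in V & g in W].

Variables (L : set 'X_{1..d}) (G : set 'X_{1..e}).

Definition rees_product : set {mpoly k[d + e]} :=
  sum_of (fun i =>
    tensor (ideal_exp (semigroup_ring k L)
                      (irrelevant_ideal (semigroup_ring_gr k L)) i)
           (semigroup_ring_gr k G i)).

(* The component of degree j is the sum of the k[L]_j (x) k[G]_i, i <= j. *)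
Definition rees_product_gr (j : nat) : set {mpoly k[d + e]} :=
  [set h | exists g : nat -> {mpoly k[d + e]},
     (forall i, tensor (semigroup_ring_gr k L j) (semigroup_ring_gr k G i)
                       (g i)) /\
     h = \sum_(i < j.+1) g i].

End ReesProduct.

Arguments rees_product k {d e} L G.
Arguments rees_product_gr k {d e} L G j.

(* Main.v *)
Require Import Defs.
From HB Require Import structures.
From mathcomp Require Import all_boot all_order all_algebra.
From mathcomp Require Import mpoly classical_sets reals boolp.

(** The algebra of the theorem is a Segre product in disguise.  Write A for
    k[Lambda] and B for k[Gamma].  Since m_A^i is the sum of the A_j with
    j >= i, the component of degree j of A * B is
    A_j (x) (B_0 + ... + B_j), and B_0 + ... + B_j is a copy of the component
    of degree j of B[t], an element of B_i being multiplied by t^(j-i).  It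
    therefore suffices that adjoining a variable and taking Segre products
    preserve Koszulness.

    Both are proved with linear modules.  A graded module is linear when it is
    generated in degree 0 and its module of first syzygies, with degrees
    lowered by one, is linear again; [linear_upto i] asks for i such steps.
    An algebra is Koszul exactly when its ideal of elements of positive degree,
    again shifted to start in degree 0, is linear ([koszul_linear],
    [koszul_of_linear]).  Linear modules are closed under extensions
    ([linear_upto_ext]) and under quotients by linear submodules
    ([linear_upto_quotient]).  Over a Koszul algebra the latter makes M_1 + M_2
    + ... linear when M is ([linear_truncation]), as it is the quotient of a
    sum of copies of the positive ideal by the syzygies of M.

    For Segre products, let M be linear over A and N linear over B, and let
    M o N be the sum of the M_n (x) N_n, a module over the Segre product of A
    and B.  A minimal free cover F -> M with kernel Z gives the exact sequence
    0 -> Z o N -> F o N -> M o N -> 0, tensor products over a field being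
    exact.  As Z starts in degree 1, the shift of Z o N is the Segre product of
    the syzygies of M with the truncation of N, two linear modules, so by
    induction it is linear for one step less than what is claimed of M o N.
    The same argument applied to N reduces F o N to a free module.  This is
    [linear_segre]; the Koszulness of the Segre product is the case where M and
    N are the positive ideals.

    For B[t], resolutions over B extend to B[t].  The positive ideal of B[t] is
    generated by t and generators y_1, ..., y_p of the one of B.  In a syzygy
    of (t, y_1, ..., y_p) the coefficient of t ranges over B_+[t], and the
    syzygies where it vanishes are the syzygies of the y_i over B, extended to
    B[t].  So the syzygies are an extension of linear modules
    ([linear_rees_positive]).

    Everything above involves homogeneous elements only.  A graded ring is
    hence given as the family of its components inside an ambient ring, whose
    sum is not assumed to be direct, and likewise for modules.  This lets B[t]
    live in the same polynomial ring as B, as the family of the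
    B_0 + ... + B_n: the variable t is the element 1, placed in degree 1. *)

Set Implicit Arguments.
Unset Strict Implicit.
Unset Printing Implicit Defensive.

Import GRing.Theory.
Local Open Scope ring_scope.

(** * Linear combinations with row vectors of coefficients *)

Section LinearCombinations.
Variable S : comNzRingType.
Implicit Types E : lmodType S.

Definition lincomb E c (v : 'rV[S]_c) (G : 'I_c -> E) : E :=
  \sum_j v 0 j *: G j.

Definition cat_fam (T : Type) p q (G : 'I_p -> T) (H : 'I_q -> T)
    (j : 'I_(p + q)) : T :=
  match split j with inl i => G i | inr i => H i end.

Section Facts.
Variables (E : lmodType S) (c : nat).
Implicit Types (v w : 'rV[S]_c) (G : 'I_c -> E).

Lemma lincombD v w G : lincomb (v + w) G = lincomb v G + lincomb w G.
Proof.
by rewrite /lincomb -big_split; apply: eq_bigr => j _; rewrite mxE scalerDl.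
Qed.

Lemma lincombZ a v G : lincomb (a *: v) G = a *: lincomb v G.
Proof.
by rewrite /lincomb scaler_sumr; apply: eq_bigr => j _; rewrite mxE scalerA.
Qed.

Lemma lincombN v G : lincomb (- v) G = - lincomb v G.
Proof. by rewrite -(scaleN1r v) lincombZ scaleN1r. Qed.

Lemma lincomb0 G : lincomb 0 G = 0.
Proof. by rewrite /lincomb big1 // => j _; rewrite mxE scale0r. Qed.

Lemma lincomb_is_linear G : linear (fun v => lincomb v G).
Proof. by move=> a v w; rewrite lincombD lincombZ. Qed.

Lemma lincomb_sum n (v : 'I_n -> 'rV[S]_c) G :
  lincomb (\sum_(i < n) v i) G = \sum_(i < n) lincomb (v i) G.
Proof.
elim: n v => [|n IH] v; first by rewrite !big_ord0 lincomb0.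
by rewrite !big_ord_recr /= lincombD IH.
Qed.

Lemma lincomb_delta j G : lincomb (delta_mx 0 j) G = G j.
Proof.
rewrite /lincomb (bigD1 j) //= mxE !eqxx scale1r big1 ?addr0 // => i /negPf nij.
by rewrite mxE nij andbF scale0r.
Qed.

Lemma eq_lincomb v G G' : G =1 G' -> lincomb v G = lincomb v G'.
Proof. by move=> e; apply: eq_bigr => j _; rewrite e. Qed.

Lemma lincomb_linear (E' : lmodType S) (f : {linear E -> E'}) v G :
  f (lincomb v G) = lincomb v (fun j => f (G j)).
Proof.
by rewrite /lincomb linear_sum; apply: eq_bigr => j _; rewrite linearZ.
Qed.

Lemma lincomb_mul p (v : 'rV[S]_p) (T : 'M[S]_(p, c)) G :
  lincomb (v *m T) G = lincomb v (fun j => lincomb (row j T) G).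
Proof.
rewrite /lincomb; under eq_bigr => j _ do rewrite mxE scaler_suml.
rewrite exchange_big; apply: eq_bigr => i _; rewrite scaler_sumr.
by apply: eq_bigr => j _; rewrite mxE scalerA.
Qed.

End Facts.

Definition lincomb_of E c (G : 'I_c -> E) (v : 'rV[S]_c) := lincomb v G.

HB.instance Definition _ E c (G : 'I_c -> E) :=
  GRing.isLinear.Build S 'rV[S]_c E _ (lincomb_of G) (lincomb_is_linear G).

Lemma lincomb_rows p c (v : 'rV[S]_p) (T : 'M[S]_(p, c)) :
  lincomb v (fun i => row i T) = v *m T.
Proof.
apply/rowP=> j; rewrite /lincomb summxE mxE; apply: eq_bigr => i _.
by rewrite !mxE.
Qed.

Lemma lincomb_matrix p q (v : 'rV[S]_p) (G : 'I_p -> 'rV[S]_q) :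
  lincomb v G = v *m \matrix_j G j.
Proof. by rewrite -lincomb_rows; apply: eq_lincomb => j; rewrite rowK. Qed.

Lemma mulmx_inl p q (u : 'rV[S]_p) :
  u *m (row_mx 1%:M 0 : 'M_(p, p + q)) = row_mx u 0.
Proof. by rewrite mul_mx_row mulmx0 mulmx1. Qed.

Lemma mulmx_inr p q (v : 'rV[S]_q) :
  v *m (row_mx 0 1%:M : 'M_(q, p + q)) = row_mx 0 v.
Proof. by rewrite mul_mx_row mulmx0 mulmx1. Qed.

Lemma mulmx_projl p q (v : 'rV[S]_(p + q)) :
  v *m (col_mx 1%:M 0 : 'M_(p + q, p)) = lsubmx v.
Proof. by rewrite -{1}[v]hsubmxK mul_row_col mulmx0 mulmx1 addr0. Qed.

Lemma mulmx_projr p q (v : 'rV[S]_(p + q)) :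
  v *m (col_mx 0 1%:M : 'M_(p + q, q)) = rsubmx v.
Proof. by rewrite -{1}[v]hsubmxK mul_row_col mulmx0 mulmx1 add0r. Qed.

Lemma lincomb_cat E p q (u : 'rV[S]_p) (v : 'rV[S]_q)
    (G : 'I_p -> E) (H : 'I_q -> E) :
  lincomb (row_mx u v) (cat_fam G H) = lincomb u G + lincomb v H.
Proof.
rewrite /lincomb big_split_ord; congr (_ + _); apply: eq_bigr => j _.
  by rewrite row_mxEl /cat_fam (unsplitK (inl _ j)).
by rewrite row_mxEr /cat_fam (unsplitK (inr _ j)).
Qed.

End LinearCombinations.

(** * Graded rings, graded modules and linear modules *)

Section GradedModules.
Variables (k : fieldType) (S : comAlgType k) (gr : nat -> set S).

(** The components may overlap, as those of the family [upto gr] below do, which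
    represents the polynomial ring in one variable over [gr]. *)
Record graded_ring : Prop := GradedRing {
  gr_subspace : forall i, is_subspace (gr i);
  gr_zero : forall f, gr 0%N f <-> exists c : k, f = c%:A;
  gr_mul : forall i j f g, gr i f -> gr j g -> gr (i + j)%N (f * g)
}.

Hypothesis Hgr : graded_ring.

Lemma gr_0 i : gr i 0. Proof. by case: (gr_subspace Hgr i). Qed.

Lemma gr_scale i (a : k) f : gr i f -> gr i (a *: f).
Proof.
by case: (gr_subspace Hgr i) => H0 H Hf; rewrite -[_ *: f]addr0; apply: H.
Qed.

Lemma gr_add i f g : gr i f -> gr i g -> gr i (f + g).
Proof.
by case: (gr_subspace Hgr i) => _ H Hf Hg; rewrite -[f]scale1r; apply: H.
Qed.

Lemma gr_opp i f : gr i f -> gr i (- f).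
Proof. by rewrite -scaleN1r; apply: gr_scale. Qed.

Lemma gr_sum i n (f : 'I_n -> S) :
  (forall j, gr i (f j)) -> gr i (\sum_(j < n) f j).
Proof.
by move=> H; elim/big_ind: _ => // [|x y]; [exact: gr_0|exact: gr_add].
Qed.

Lemma gr_const (c : k) : gr 0%N c%:A.
Proof. by apply/(gr_zero Hgr); exists c. Qed.

Lemma gr_1 : gr 0%N 1.
Proof. by rewrite -[1]scale1r; apply: gr_const. Qed.

Lemma gr_mul0l i f g : gr 0%N f -> gr i g -> gr i (f * g).
Proof. exact: (gr_mul Hgr). Qed.

Notation hrow n v := (row_over (gr n) v).

Lemma hrow_0 n c : hrow n (0 : 'rV[S]_c).
Proof. by move=> j; rewrite mxE; apply: gr_0. Qed.

Lemma hrow_add n c (u v : 'rV[S]_c) : hrow n u -> hrow n v -> hrow n (u + v).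
Proof. by move=> Hu Hv j; rewrite mxE; apply: gr_add. Qed.

Lemma hrow_opp n c (u : 'rV[S]_c) : hrow n u -> hrow n (- u).
Proof. by move=> Hu j; rewrite mxE; apply: gr_opp. Qed.

Lemma hrow_scale m n c f (u : 'rV[S]_c) :
  gr m f -> hrow n u -> hrow (m + n) (f *: u).
Proof. by move=> Hf Hu j; rewrite mxE; apply: (gr_mul Hgr). Qed.

Lemma hrow_mul m n p q (u : 'rV[S]_p) (T : 'M[S]_(p, q)) :
  hrow m u -> (forall i j, gr n (T i j)) -> hrow (m + n) (u *m T).
Proof.
by move=> Hu HT j; rewrite mxE; apply: gr_sum => i; apply: (gr_mul Hgr).
Qed.

Lemma hrow_mul0 m p q (u : 'rV[S]_p) (T : 'M[S]_(p, q)) :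
  hrow m u -> (forall i j, gr 0%N (T i j)) -> hrow m (u *m T).
Proof. by rewrite -[X in _ -> _ -> hrow X _]addn0; apply: hrow_mul. Qed.

Lemma hrow_cat n p q (u : 'rV[S]_p) (v : 'rV[S]_q) :
  hrow n (row_mx u v) <-> hrow n u /\ hrow n v.
Proof.
split=> [H|[Hu Hv] j].
  by split=> j; [have := H (lshift q j)|have := H (rshift p j)];
     rewrite ?row_mxEl ?row_mxEr.
by rewrite mxE; case: (split j).
Qed.

Lemma hrow_delta c (j : 'I_c) : hrow 0%N (delta_mx 0 j : 'rV[S]_c).
Proof.
by move=> i; rewrite mxE; case: (_ && _); [exact: gr_1|exact: gr_0].
Qed.

Lemma hrow_closed n c (a : k) (u v : 'rV[S]_c) :
  hrow n u -> hrow n v -> hrow n (u + a%:A *: v).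
Proof.
move=> Hu Hv; apply: hrow_add => //.
by apply: (hrow_scale (m := 0%N)) => //; apply: gr_const.
Qed.

Record graded_module (E : lmodType S) (M : nat -> set E) : Prop :=
  GradedModule {
  gm_0 : forall n, M n 0;
  gm_add : forall n u v, M n u -> M n v -> M n (u + v);
  gm_act : forall m n f u, gr m f -> M n u -> M (m + n)%N (f *: u)
}.

Lemma gm_opp (E : lmodType S) (M : nat -> set E) n u :
  graded_module M -> M n u -> M n (- u).
Proof.
move=> HM Hu; rewrite -scaleN1r.
by apply: (gm_act HM (m := 0%N)) => //; apply: gr_opp gr_1.
Qed.

Lemma gm_lincomb (E : lmodType S) (M : nat -> set E) m n c
    (v : 'rV[S]_c) (G : 'I_c -> E) :
  graded_module M -> hrow m v -> (forall j, M n (G j)) ->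
  M (m + n)%N (lincomb v G).
Proof.
move=> HM Hv HG; rewrite /lincomb.
elim/big_ind: _ => [|x y|j _]; [exact: gm_0|exact: gm_add|].
exact: gm_act.
Qed.

(** The degrees are lowered by one, so that the syzygies of a minimal set of
    generators of degree 0 of a linear module are generated in degree 0. *)
Definition syzygy (E : lmodType S) c (G : 'I_c -> E) (n : nat) : set 'rV[S]_c :=
  fun v => hrow n.+1 v /\ lincomb v G = 0.

(** [G] is a minimal set of generators of [M], all of degree 0: the second
    clause says that the free cover it defines has no kernel in degree 0, which
    is what makes [syzygy G] the whole kernel up to the shift. *)
Definition free_gens (E : lmodType S) (M : nat -> set E) c (G : 'I_c -> E) :=
  (forall n u, M n u <-> exists2 v : 'rV[S]_c, hrow n v & u = lincomb v G) /\
  (forall v : 'rV[S]_c, hrow 0%N v -> lincomb v G = 0 -> v = 0).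

(** Being linear for [i] steps is the same as the vanishing of Tor_s(M, k)_t
    for s < i and t <> s, together with the finiteness of its first [i] Betti
    numbers; this form needs neither Tor nor graded free modules.  The number
    of steps is explicit because linearity is proved by induction on it. *)
Fixpoint linear_upto (i : nat) :
    forall E : lmodType S, (nat -> set E) -> Prop :=
  match i with
  | 0 => fun _ _ => True
  | i'.+1 => fun E M => exists c (G : 'I_c -> E),
      free_gens M G /\ linear_upto i' (syzygy G)
  end.

Definition linear_mod (E : lmodType S) (M : nat -> set E) :=
  forall i, linear_upto i M.

Lemma graded_syzygy (E : lmodType S) c (G : 'I_c -> E) :
  graded_module (syzygy G).
Proof.
split=> [n|n u v [Hu u0] [Hv v0]|m n f u Hf [Hu u0]]; split.
- exact: hrow_0.
- exact: lincomb0.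
- exact: hrow_add.
- by rewrite lincombD u0 v0 addr0.
- by rewrite -addnS; apply: hrow_scale.
- by rewrite lincombZ u0 scaler0.
Qed.

Lemma free_gens_in (E : lmodType S) (M : nat -> set E) c (G : 'I_c -> E) j :
  free_gens M G -> M 0%N (G j).
Proof.
by case=> H _; apply/H; exists (delta_mx 0 j);
  [exact: hrow_delta|rewrite lincomb_delta].
Qed.

Lemma graded_free_gens (E : lmodType S) (M : nat -> set E) c (G : 'I_c -> E) :
  free_gens M G -> graded_module M.
Proof.
move=> fG; split=> [n|n u v /(fG.1)[x Hx ->] /(fG.1)[y Hy ->]|
    m n f u Hf /(fG.1)[x Hx ->]]; apply/(fG.1).
- by exists 0; [exact: hrow_0|rewrite lincomb0].
- by exists (x + y); [exact: hrow_add|rewrite lincombD].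
- by exists (f *: x); [exact: hrow_scale|rewrite lincombZ].
Qed.

Lemma eq_linear_upto i (E : lmodType S) (M M' : nat -> set E) :
  (forall n u, M n u <-> M' n u) -> linear_upto i M -> linear_upto i M'.
Proof.
case: i => [|i] //= e [c [G [[H1 H2] H3]]]; exists c, G; split=> //; split=> //.
by move=> n u; rewrite -e.
Qed.

(** Transporting the generators along the isomorphism leaves the syzygies
    unchanged, so there is no induction on the number of steps. *)
Lemma linear_upto_iso i (E E' : lmodType S) (M : nat -> set E)
    (M' : nat -> set E') (f : {linear E -> E'}) :
  (forall n w, M' n w <-> exists2 u, M n u & w = f u) ->
  (forall n u, M n u -> f u = 0 -> u = 0) ->
  linear_upto i M -> linear_upto i M'.
Proof.
case: i => [|i] //= im inj [c [G [[H1 H2] H3]]].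
exists c, (fun j => f (G j)); split; first split.
- move=> n w; rewrite im; split=> [[u /H1[v Hv ->] ->]|[v Hv ->]].
    by exists v => //; rewrite lincomb_linear.
  by exists (lincomb v G); [apply/H1; exists v|rewrite lincomb_linear].
- move=> v Hv; rewrite -lincomb_linear => v0; apply: H2 => //.
  by apply: (inj 0%N) => //; apply/H1; exists v.
apply: eq_linear_upto H3 => n v; split=> -[Hv v0]; split=> //.
  by rewrite -lincomb_linear v0 linear0.
move: v0; rewrite -lincomb_linear; apply: (inj n.+1).
by apply/H1; exists v.
Qed.

Lemma free_gens_trans (E : lmodType S) (M : nat -> set E) c c'
    (G : 'I_c -> E) (G' : 'I_c' -> E) :
  free_gens M G -> free_gens M G' ->
  exists T : 'M[S]_(c', c), (forall i j, gr 0%N (T i j)) /\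
    forall j, G' j = lincomb (row j T) G.
Proof.
move=> fG fG'.
have /choice[t Ht] : forall j, exists v : 'rV[S]_c,
    hrow 0%N v /\ G' j = lincomb v G.
  by move=> j; have /(fG.1)[v] := free_gens_in j fG'; exists v.
exists (\matrix_j t j); split=> [i j|j]; first by rewrite mxE; case: (Ht i).
by rewrite rowK; case: (Ht j).
Qed.

(** Minimality makes the two changes of generators inverse to each other. *)
Lemma free_gens_transK (E : lmodType S) (M : nat -> set E) c c'
    (G : 'I_c -> E) (G' : 'I_c' -> E) (T : 'M[S]_(c', c)) (T' : 'M[S]_(c, c')) :
  free_gens M G ->
  (forall i j, gr 0%N (T i j)) -> (forall i j, gr 0%N (T' i j)) ->
  (forall j, G' j = lincomb (row j T) G) ->
  (forall j, G j = lincomb (row j T') G') -> T' *m T = 1%:M.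
Proof.
move=> [_ fG] HT HT' e e'; apply/row_matrixP => j; apply/eqP.
rewrite -subr_eq0; apply/eqP; apply: fG.
  apply: hrow_add.
    by rewrite row_mul; apply: hrow_mul0 => // i; rewrite mxE.
  by rewrite row1; apply/hrow_opp/hrow_delta.
rewrite lincombD lincombN row_mul row1 lincomb_delta lincomb_mul.
by rewrite -(eq_lincomb _ e) -e' subrr.
Qed.

(** Two minimal sets of generators differ by an invertible matrix of degree 0,
    which induces an isomorphism of the syzygies.  Linearity can thus be tested
    on any set of generators at hand. *)
Lemma linear_upto_basis i (E : lmodType S) (M : nat -> set E) c c'
    (G : 'I_c -> E) (G' : 'I_c' -> E) :
  free_gens M G -> free_gens M G' ->
  linear_upto i (syzygy G) -> linear_upto i (syzygy G').
Proof.
move=> fG fG'; have [T [HT eT]] := free_gens_trans fG fG'.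
have [T' [HT' eT']] := free_gens_trans fG' fG.
have TT' := free_gens_transK fG' HT' HT eT' eT.
have T'T := free_gens_transK fG HT HT' eT eT'.
apply: (linear_upto_iso (f := mulmxr T')) => [n w|n v [Hv v0] /= e].
  split=> [[Hw w0]|[v [Hv v0] ->]] /=; last first.
    split; first exact: hrow_mul0.
    by rewrite lincomb_mul -(eq_lincomb _ eT').
  exists (w *m T); last by rewrite -mulmxA TT' mulmx1.
  split; first exact: hrow_mul0.
  by rewrite lincomb_mul -(eq_lincomb _ eT).
by rewrite -[v]mulmx1 -T'T mulmxA e mul0mx.
Qed.

(** The definition chooses new generators for each number of steps; a single
    choice serves all of them. *)
Lemma linear_modP (E : lmodType S) (M : nat -> set E) :
  linear_mod M -> exists c (G : 'I_c -> E),
    free_gens M G /\ linear_mod (syzygy G).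
Proof.
move=> HM; have [c [G [fG _]]] := HM 1%N; exists c, G; split=> // i.
by have [c' [G' [fG' H]]] := HM i.+1; apply: linear_upto_basis fG' fG H.
Qed.

(** * Exact sequences of linear modules *)

Record short_exact (EX EY EZ : lmodType S) (X : nat -> set EX)
    (Y : nat -> set EY) (Z : nat -> set EZ)
    (f : {linear EX -> EY}) (g : {linear EY -> EZ}) : Prop := ShortExact {
  se_in : forall n u, X n u -> Y n (f u);
  se_inj : forall n u, X n u -> f u = 0 -> u = 0;
  se_zero : forall n u, X n u -> g (f u) = 0;
  se_ker : forall n v, Y n v -> g v = 0 -> exists2 u, X n u & v = f u;
  se_surj : forall n w, Z n w <-> exists2 v, Y n v & w = g v
}.

Section ShortExact.
Variables (EX EY EZ : lmodType S).
Variables (X : nat -> set EX) (Y : nat -> set EY) (Z : nat -> set EZ).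
Variables (f : {linear EX -> EY}) (g : {linear EY -> EZ}).
Hypothesis HY : graded_module Y.
Hypothesis E : short_exact X Y Z f g.
Variables (p q : nat) (GX : 'I_p -> EX) (H : 'I_q -> EY).

(** Generators of the middle term: those of the kernel and lifts of those of
    the quotient. *)
Lemma short_exact_gens :
  free_gens X GX -> (forall j, Y 0%N (H j)) -> free_gens Z (fun j => g (H j)) ->
  free_gens Y (cat_fam (fun j => f (GX j)) H).
Proof.
move=> fX YH fZ; have fGY j : Y 0%N (f (GX j)).
  exact: (se_in E (free_gens_in j fX)).
split=> [n v|v].
  split=> [Yv|[w]].
    have /(fZ.1)[w Hw ew] : Z n (g v) by apply/(se_surj E); exists v.
    have Yd : Y n (v - lincomb w H).
      apply: (gm_add HY) => //; apply: gm_opp => //.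
      by rewrite -[n]addn0; apply: gm_lincomb.
    have [|u /(fX.1)[w' Hw' ->] eu] := se_ker E Yd.
      by rewrite linearB /= ew lincomb_linear subrr.
    exists (row_mx w' w); first by apply/hrow_cat.
    by rewrite lincomb_cat -lincomb_linear -eu subrK.
  rewrite -[w]hsubmxK => /hrow_cat[Hl Hr] ->; rewrite lincomb_cat.
  by apply: (gm_add HY); rewrite -[n]addn0; apply: gm_lincomb.
rewrite -[v]hsubmxK => /hrow_cat[]; move: (lsubmx v) (rsubmx v) => w' w Hw' Hw.
rewrite lincomb_cat -lincomb_linear => e.
have Xw' : X 0%N (lincomb w' GX) by apply/(fX.1); exists w'.
have w0 : w = 0.
  apply: (fZ.2) => //; rewrite -lincomb_linear.
  by move: (congr1 g e); rewrite linearD (se_zero E Xw') add0r linear0.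
move: e; rewrite w0 lincomb0 addr0 => /(se_inj E Xw') /(fX.2) -> //.
by rewrite row_mx0.
Qed.

(** The snake lemma for the free covers: the short exact sequence is covered
    by a split sequence of free modules, and the kernels form an exact
    sequence again.  This drives every induction on the number of steps. *)
Lemma short_exact_syzygy :
  free_gens X GX -> (forall j, Y 0%N (H j)) -> free_gens Z (fun j => g (H j)) ->
  short_exact (syzygy GX) (syzygy (cat_fam (fun j => f (GX j)) H))
    (syzygy (fun j => g (H j)))
    (mulmxr (row_mx 1%:M 0 : 'M[S]_(p, p + q)))
    (mulmxr (col_mx 0 1%:M : 'M[S]_(p + q, q))).
Proof.
move=> fX YH fZ.
have zE n u : X n u -> g (f u) = 0 := se_zero E (n := n) (u := u).
split=> [n u [Hu u0]|n u _|n u _|n v|n w] /=; rewrite ?mulmx_inl ?mulmx_projr.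
- split; first by apply/hrow_cat; split=> //; apply: hrow_0.
  by rewrite lincomb_cat lincomb0 addr0 -lincomb_linear u0 linear0.
- by move=> /(congr1 lsubmx); rewrite row_mxKl linear0.
- by rewrite row_mxKr.
- rewrite -[v]hsubmxK; move: (lsubmx v) (rsubmx v) => w' w [/hrow_cat[Hw' _]].
  rewrite row_mxKr => ev w0; exists w'; last by rewrite mulmx_inl w0.
  split=> //; move: ev; rewrite lincomb_cat w0 lincomb0 addr0 -lincomb_linear.
  by apply: (se_inj E (n := n.+1)); apply/(fX.1); exists w'.
split=> [[Hw w0]|[v]]; last first.
  rewrite mulmx_projr -[v]hsubmxK; move: (lsubmx v) (rsubmx v) => w' u.
  move=> [/hrow_cat[Hw' Hu]].
  rewrite lincomb_cat row_mxKr => ev ->; split=> //.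
  rewrite -lincomb_linear; move: (congr1 g ev).
  rewrite linearD -lincomb_linear (zE n.+1) ?add0r ?linear0 //.
  by apply/(fX.1); exists w'.
have Yw : Y n.+1 (lincomb w H) by rewrite -[n.+1]addn0; apply: gm_lincomb.
have [|u /(fX.1)[w' Hw' ->] eu] := se_ker E Yw; first by rewrite lincomb_linear.
exists (row_mx (- w') w); last by rewrite mulmx_projr row_mxKr.
split; first by apply/hrow_cat; split=> //; apply: hrow_opp.
by rewrite lincomb_cat lincombN -lincomb_linear -eu addNr.
Qed.

End ShortExact.

(** The generators of the outer terms assemble into generators of the middle
    one, and the syzygies form an extension of the same kind. *)
Lemma linear_upto_ext i (EX EY EZ : lmodType S) (X : nat -> set EX)
    (Y : nat -> set EY) (Z : nat -> set EZ)
    (f : {linear EX -> EY}) (g : {linear EY -> EZ}) :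
  graded_module Y -> short_exact X Y Z f g ->
  linear_upto i X -> linear_upto i Z -> linear_upto i Y.
Proof.
elim: i EX EY EZ X Y Z f g => [|i IH] //= EX EY EZ X Y Z f g HY E.
move=> [p [GX [fX lX]]] [q [GZ [fZ lZ]]].
have /choice[H HP] : forall j, exists v, Y 0%N v /\ GZ j = g v.
  by move=> j; have /(se_surj E)[v] := free_gens_in j fZ; exists v.
have YH j : Y 0%N (H j) by case: (HP j).
have eGZ : GZ = (fun j => g (H j)) by apply/funext => j; case: (HP j).
rewrite {}eGZ in fZ lZ.
exists (p + q)%N, (cat_fam (fun j => f (GX j)) H).
split; first exact (short_exact_gens HY E fX YH fZ).
apply: (IH _ _ _ _ _ _ _ _ (graded_syzygy _) _ lX lZ).
exact (short_exact_syzygy HY E fX YH fZ).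
Qed.

(** The completed matrix is not of square type, so its invertibility is
    expressed by an explicit inverse on both sides. *)
Lemma complete_row_free p q (T : 'M[k]_(p, q)) :
  row_free T -> exists r (U : 'M[k]_(r, q)) (V : 'M[k]_(q, p + r)),
    col_mx T U *m V = 1%:M /\ V *m col_mx T U = 1%:M.
Proof.
move=> fT; pose U := row_base (T^C)%MS; exists (\rank (T^C)%MS), U.
have full : row_full (col_mx T U).
  have := addsmx_compl_full T; rewrite -!sub1mx => /submx_trans; apply.
  by rewrite -addsmxE addsmxS // eq_row_base.
have e : (p + \rank (T^C)%MS)%N = q.
  by rewrite mxrank_compl; have := rank_leq_col T; rewrite (eqP fT) => /subnKC.
have free : row_free (col_mx T U).
  by rewrite /row_free (eqP full) e.
exists (pinvmx (col_mx T U)); split; last exact: mulVpmx.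
by rewrite mulmxVp.
Qed.

(** As X and Y are both generated in degree 0, generators of X form a linearly
    independent family in the degree 0 part of Y, which can be completed to
    generators of Y; those added generate Z.  With these generators
    [short_exact_syzygy] gives an exact sequence of the same kind.  The
    analogue for Tor is that Tor_i(Z) lies between Tor_i(Y), in degree i, and
    Tor_(i-1)(X), in degree i - 1, while it vanishes in degrees below i. *)
Lemma linear_upto_quotient i (EX EY EZ : lmodType S) (X : nat -> set EX)
    (Y : nat -> set EY) (Z : nat -> set EZ)
    (f : {linear EX -> EY}) (g : {linear EY -> EZ}) :
  graded_module Y -> short_exact X Y Z f g ->
  linear_upto i X -> linear_upto i Y -> linear_upto i Z.
Proof.
elim: i EX EY EZ X Y Z f g => [|i IH] //= EX EY EZ X Y Z f g HY E.
move=> [p [GX [fX lX]]] [q [GY [fY lY]]].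
have /choice[t Ht] : forall j, exists t : 'rV[k]_q,
    f (GX j) = lincomb (map_mx (in_alg S) t) GY.
  move=> j; have /(fY.1)[v Hv ev] := se_in E (free_gens_in j fX).
  have /choice[t Ht] : forall l, exists a : k, v 0 l = a%:A.
    by move=> l; apply/(gr_zero Hgr).
  exists (\row_l t l); rewrite ev; congr lincomb.
  by apply/rowP=> l; rewrite !mxE Ht.
pose T := \matrix_j t j; pose A r s (N : 'M[k]_(r, s)) := map_mx (in_alg S) N.
have A0 r s (N : 'M[k]_(r, s)) i1 i2 : gr 0%N (A _ _ N i1 i2).
  by rewrite mxE; apply: gr_const.
have eT v : f (lincomb v GX) = lincomb (v *m A _ _ T) GY.
  rewrite lincomb_linear lincomb_mul; apply: eq_lincomb => j.
  by rewrite Ht -map_row rowK.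
have A_inj r s (N : 'M[k]_(r, s)) : A _ _ N = 0 -> N = 0.
  move=> /matrixP N0; apply/matrixP => a b; have := N0 a b.
  rewrite !mxE => /eqP; by rewrite scaler_eq0 oner_eq0 orbF => /eqP.
have fT : row_free T.
  apply: inj_row_free => v v0; apply: A_inj; apply: (fX.2); first exact: A0.
  apply: (se_inj E (n := 0%N)).
    by apply/(fX.1); exists (A _ _ v) => // j; apply: A0.
  by rewrite eT -map_mxM v0 map_mx0 lincomb0.
(* The generators H complete those of X to generators of Y. *)
have [r [U [V [UV VU]]]] := complete_row_free fT.
pose H j := lincomb (row j (A _ _ U)) GY.
have YH j : Y 0%N (H j).
  by apply/(fY.1); exists (row j (A _ _ U)) => // a; rewrite mxE; apply: A0.
have eG v : lincomb v (cat_fam (fun j => f (GX j)) H)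
            = lincomb (v *m A _ _ (col_mx T U)) GY.
  rewrite -[v]hsubmxK lincomb_cat -lincomb_linear eT -lincomb_mul -lincombD.
  by rewrite /A map_col_mx mul_row_col.
have fG : free_gens Y (cat_fam (fun j => f (GX j)) H).
  split=> [n u|v Hv].
    split=> [/(fY.1)[v Hv ->]|[v Hv ->]].
      exists (v *m A _ _ V); first exact: hrow_mul0.
      by rewrite eG -mulmxA -map_mxM VU map_mx1 mulmx1.
    rewrite eG; apply/(fY.1); exists (v *m A _ _ (col_mx T U)) => //.
    exact: hrow_mul0.
  rewrite eG => /(fY.2) v0; rewrite -[v]mulmx1.
  rewrite -(map_mx1 (in_alg S)) -UV map_mxM mulmxA v0 ?mul0mx //.
  exact: hrow_mul0.
have fZ : free_gens Z (fun j => g (H j)).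
  split=> [n w|v Hv].
    rewrite (se_surj E); split=> [[u /(fG.1)[v Hv ->] ->]|[v Hv ->]].
      move: Hv; rewrite -[v]hsubmxK => /hrow_cat[Hl Hr].
      exists (rsubmx v) => //; rewrite lincomb_cat -lincomb_linear linearD.
      rewrite (se_zero E (n := n)) ?add0r ?lincomb_linear //.
      by apply/(fX.1); exists (lsubmx v).
    exists (lincomb v H); last by rewrite lincomb_linear.
    by rewrite -[n]addn0; apply: gm_lincomb.
  rewrite -lincomb_linear => v0.
  have YHv : Y 0%N (lincomb v H) by rewrite -[0%N]addn0; apply: gm_lincomb.
  have [u /(fX.1)[w Hw ->] ew] := se_ker E YHv v0.
  have /(congr1 rsubmx) : row_mx (- w) v = 0.
    apply: (fG.2); first by apply/hrow_cat; split=> //; apply: hrow_opp.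
    by rewrite lincomb_cat lincombN -lincomb_linear ew addNr.
  by rewrite row_mxKr linear0.
exists r, (fun j => g (H j)); split=> //.
apply: (IH _ _ _ _ _ _ _ _ (graded_syzygy _) _ lX).
  exact (short_exact_syzygy HY E fX YH fZ).
exact: linear_upto_basis fY fG lY.
Qed.

(** The kernel of F -> M starts in degree 1, so M and F have the same
    generators and the syzygies of M are an extension of the kernel by the
    syzygies of F. *)
Lemma linear_upto_cover i (EF EM : lmodType S) (F : nat -> set EF)
    (M : nat -> set EM) (g : {linear EF -> EM}) :
  graded_module F ->
  (forall n w, M n w <-> exists2 u, F n u & w = g u) ->
  (forall u, F 0%N u -> g u = 0 -> u = 0) ->
  linear_upto i.+1 F -> linear_upto i (fun n u => F n.+1 u /\ g u = 0) ->
  linear_upto i.+1 M.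
Proof.
move=> HF im inj [c [G [fG lG]]] lN; exists c, (fun j => g (G j)).
split; first split.
- move=> n w; rewrite im; split=> [[u /(fG.1)[v Hv ->] ->]|[v Hv ->]].
    by exists v => //; rewrite lincomb_linear.
  by exists (lincomb v G); [apply/(fG.1); exists v|rewrite lincomb_linear].
- move=> v Hv; rewrite -lincomb_linear => v0; apply: (fG.2) => //.
  by apply: inj => //; apply/(fG.1); exists v.
apply: (linear_upto_ext (f := idfun) (g := lincomb_of G)
  (graded_syzygy _) _ lG lN).
split=> [n u [Hu u0]|//|n u [Hu u0]//|n v [Hv v0] /= e|n w].
- by split=> //=; rewrite -lincomb_linear u0 linear0.
- by exists v.
split=> [[/(fG.1)[v Hv ->] gv]|[v [Hv v0] ->]].
  by exists v => //; split=> //; rewrite -lincomb_linear.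
split; first by apply/(fG.1); exists v.
by rewrite lincomb_linear.
Qed.

Lemma linear_upto_zero i (E : lmodType S) (M : nat -> set E) :
  (forall n u, M n u <-> u = 0) -> linear_upto i M.
Proof.
elim: i E M => [|i IH] //= E M H; exists 0%N, (fun=> 0); split; first split.
- move=> n u; rewrite H.
  split=> [->|[v _ ->]]; last by rewrite /lincomb big_ord0.
  by exists 0; [exact: hrow_0|rewrite lincomb0].
- by move=> v _ _; apply/rowP => -[].
apply: IH => n u; split=> [_|->]; first by apply/rowP => -[].
by split; [exact: hrow_0|rewrite lincomb0].
Qed.

(** For c = 1 this is the ideal of elements of positive degree, shifted to start
    in degree 0, and the ring is Koszul when it is linear. *)
Definition positive_rows c (n : nat) : set 'rV[S]_c := fun v => hrow n.+1 v.

Lemma graded_positive_rows c : graded_module (@positive_rows c).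
Proof.
split=> [n|n u v|m n f u Hf Hu]; [exact: hrow_0|exact: hrow_add|].
by rewrite /positive_rows -addnS; apply: hrow_scale.
Qed.

Hypothesis Hlin : linear_mod (@positive_rows 1).

Lemma linear_positive_rows c : linear_mod (@positive_rows c).
Proof.
move=> i; elim: c => [|c IH].
  apply: linear_upto_zero => n u; split=> [_|->]; last exact: hrow_0.
  by apply/rowP => -[].
apply: (linear_upto_ext (Y := @positive_rows (1 + c))
  (f := mulmxr (row_mx 1%:M 0 : 'M[S]_(1, 1 + c)))
  (g := mulmxr (col_mx 0 1%:M : 'M[S]_(1 + c, c)))
  (graded_positive_rows _) _ (@Hlin i) IH).
split=> [n u Hu|n u _|n u _|n v|n w] /=; rewrite ?mulmx_inl ?mulmx_projr.
- by apply/hrow_cat; split=> //; apply: hrow_0.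
- by move=> /(congr1 lsubmx); rewrite row_mxKl linear0.
- by rewrite row_mxKr.
- rewrite -[v]hsubmxK => /hrow_cat[Hl _]; rewrite row_mxKr => ->.
  by exists (lsubmx v); rewrite ?mulmx_inl.
split=> [Hw|[v Hv ->]].
  exists (row_mx 0 w); last by rewrite mulmx_projr row_mxKr.
  by apply/hrow_cat; split=> //; apply: hrow_0.
by move: Hv; rewrite mulmx_projr -[v]hsubmxK => /hrow_cat[_]; rewrite row_mxKr.
Qed.

(** Over a Koszul ring: with G minimal generators of M, the map from c copies
    of the positive ideal to M_1 + M_2 + ... has kernel [syzygy G]. *)
Lemma linear_truncation (E : lmodType S) (M : nat -> set E) :
  linear_mod M -> linear_mod (fun n => M n.+1).
Proof.
move=> /linear_modP[c [G [fG lG]]] i.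
apply: (linear_upto_quotient (f := idfun) (g := lincomb_of G)
  (graded_positive_rows c) _ (@lG i) (@linear_positive_rows c i)).
split=> [n u [Hu u0]|//|n u [Hu u0]//|n v Hv /= e|n w].
- exact: Hu.
- by exists v.
exact: (fG.1).
Qed.

Lemma linear_free p q :
  linear_mod (fun n (W : 'M[S]_(p, q)) => forall i j, gr n (W i j)).
Proof.
case=> [//|i] /=; exists (p * q)%N, (fun j => vec_mx (delta_mx 0 j)).
have E (v : 'rV[S]_(p * q)) :
    lincomb v (fun j => vec_mx (delta_mx 0 j)) = vec_mx v.
  by rewrite -lincomb_linear /lincomb -row_sum_delta.
split; first split.
- move=> n W; split=> [HW|[v Hv ->] a b]; last by rewrite E mxE.
  exists (mxvec W); last by rewrite E mxvecK.
  by move=> j; case/mxvec_indexP: j => a b; rewrite mxvecE.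
- by move=> v _; rewrite E => /(congr1 mxvec); rewrite vec_mxK linear0.
apply: linear_upto_zero => n u; split=> [[_]|->].
  by rewrite E => /(congr1 mxvec); rewrite vec_mxK linear0.
by split; [exact: hrow_0|rewrite lincomb0].
Qed.

End GradedModules.

(** * Separating the two groups of variables *)

Section SplitVariables.
Variables (k : fieldType) (d e : nat).
Notation SA := {mpoly k[d]}.
Notation SB := {mpoly k[e]}.
Notation SC := {mpoly k[d + e]}.

HB.instance Definition _ := GRing.RMorphism.copy (@inj_left k d e)
  (comp_mpoly [tuple 'X_(lshift e i) | i < d]).
HB.instance Definition _ := GRing.RMorphism.copy (@inj_right k d e)
  (comp_mpoly [tuple 'X_(rshift d i) | i < e]).

Lemma inj_leftZ c (a : SA) : inj_left e (c *: a) = c *: inj_left e a.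
Proof. exact: comp_mpolyZ. Qed.

Lemma inj_rightZ c (b : SB) : inj_right d (c *: b) = c *: inj_right d b.
Proof. exact: comp_mpolyZ. Qed.

(** The isomorphism of k[x, y] with k[x][y].  Its coefficients give enough
    functionals to detect linear independence in a tensor product inside
    k[x, y]. *)
Definition split_vars : SC -> {mpoly SA[e]} :=
  mmap ((@mpolyC e SA) \o (@mpolyC d k))
    (fun i => match split i with inl i => ('X_i)%:MP | inr j => 'X_j end).

HB.instance Definition _ := GRing.RMorphism.on split_vars.

Lemma split_varsC c : split_vars c%:MP = c%:MP%:MP.
Proof. by rewrite /split_vars mmapC. Qed.

Lemma split_varsX m : split_vars 'X_[m] = \prod_(i < d + e)
  (match split i with inl i => ('X_i)%:MP | inr j => 'X_j end) ^+ m i.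
Proof. by rewrite /split_vars mmapX. Qed.

Lemma split_vars_left (a : SA) : split_vars (inj_left e a) = a%:MP.
Proof.
rewrite /inj_left /comp_mpoly {1}/mmap rmorph_sum [RHS](congr1 _ (mpolyE a)).
rewrite raddf_sum; apply: eq_bigr => m _; rewrite rmorphM /= /split_vars mmapC.
rewrite -mul_mpolyC rmorphM; congr (_ * _); rewrite mpolyXE_id !rmorph_prod.
apply: eq_bigr => i _; rewrite !rmorphXn /= tnth_mktuple mmapX mmap1U.
by rewrite (unsplitK (inl _ i)).
Qed.

Lemma split_vars_right (b : SB) :
  split_vars (inj_right d b) = map_mpoly (@mpolyC d k) b.
Proof.
rewrite /inj_right /comp_mpoly {1}/mmap rmorph_sum.
apply: eq_bigr => m _; rewrite rmorphM /= /split_vars mmapC /=; congr (_ * _).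
rewrite rmorph_prod; apply: eq_bigr => i _.
by rewrite !rmorphXn /= tnth_mktuple mmapX mmap1U (unsplitK (inr _ i)).
Qed.

Definition coef_right (m : 'X_{1..e}) (h : SC) : SA := (split_vars h)@_m.

HB.instance Definition _ m :=
  GRing.Additive.copy (coef_right m) (mcoeff m \o split_vars).

Lemma coef_right_prod m a b :
  coef_right m (inj_left e a * inj_right d b) = b@_m *: a.
Proof.
rewrite /coef_right rmorphM /= split_vars_left split_vars_right mul_mpolyC.
by rewrite mcoeffZ mcoeff_map_mpoly mulrC mul_mpolyC.
Qed.

Definition merge_vars (p : {mpoly SA[e]}) : SC :=
  mmap (@inj_left k d e) (fun j => 'X_(rshift d j)) p.

Lemma split_varsK : cancel split_vars merge_vars.
Proof.
move=> h; rewrite [in LHS](mpolyE h) [split_vars _]raddf_sum /merge_vars.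
rewrite raddf_sum [RHS]mpolyE.
apply: eq_bigr => m _; rewrite -!mul_mpolyC /= !rmorphM /=.
rewrite split_varsC mmapC /=; congr (_ * _); first exact: comp_mpolyC.
rewrite split_varsX rmorph_prod mpolyXE_id; apply: eq_bigr => i _.
rewrite rmorphXn; congr (_ ^+ _) => /=; rewrite -{2}[i]splitK.
case: (split i) => j /=; last by rewrite mmapX mmap1U.
by rewrite mmapC /= /inj_left comp_mpolyXU -tnth_nth tnth_mktuple.
Qed.

Lemma coef_right_eq0 h : (forall m, coef_right m h = 0) -> h = 0.
Proof.
move=> H; rewrite -[h]split_varsK.
suff -> : split_vars h = 0 by rewrite /merge_vars raddf0.
by apply/mpolyP=> m; rewrite mcoeff0; apply: H.
Qed.

End SplitVariables.

(** * Tensor products of subspaces *)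

Section PairSpan.
Variables (T U : Type) (W : zmodType) (tau : T -> U -> W).

(** For a pairing that embeds a tensor product into [W], the image of the
    tensor product of two subspaces: as [P] and [Q] are closed under scaling in
    every use, sums of pure tensors suffice. *)
Definition pair_span (P : set T) (Q : set U) : set W := fun w =>
  exists r (u : 'I_r -> T) (v : 'I_r -> U),
    [/\ forall j, P (u j), forall j, Q (v j) & w = \sum_j tau (u j) (v j)].

Lemma pair_span0 P Q : pair_span P Q 0.
Proof.
have f (X : Type) : 'I_0 -> X by case.
by exists 0%N, (f T), (f U); split=> [[]|[]|] //; rewrite big_ord0.
Qed.

Lemma pair_spanD P Q w w' :
  pair_span P Q w -> pair_span P Q w' -> pair_span P Q (w + w').
Proof.
move=> [r [u [v [Pu Qv ->]]]] [r' [u' [v' [Pu' Qv' ->]]]].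
exists (r + r')%N, (cat_fam u u'), (cat_fam v v'); split=> [j|j|].
- by rewrite /cat_fam; case: split.
- by rewrite /cat_fam; case: split.
rewrite big_split_ord /cat_fam; congr (_ + _); apply: eq_bigr => j _.
  by rewrite (unsplitK (inl _ j)).
by rewrite (unsplitK (inr _ j)).
Qed.

Lemma pair_span1 (P : set T) (Q : set U) t u :
  P t -> Q u -> pair_span P Q (tau t u).
Proof.
move=> Pt Qu; exists 1%N, (fun=> t), (fun=> u); split=> //.
by rewrite big_ord1.
Qed.

Lemma pair_span_sum P Q I (s : seq I) (w : I -> W) :
  (forall i, pair_span P Q (w i)) -> pair_span P Q (\sum_(i <- s) w i).
Proof.
move=> H; elim/big_ind: _ => // [|x y]; [exact: pair_span0|exact: pair_spanD].
Qed.

Lemma pair_span_ind (P : set T) (Q : set U) (X : set W) :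
  X 0 -> (forall w w', X w -> X w' -> X (w + w')) ->
  (forall t u, P t -> Q u -> X (tau t u)) -> forall w, pair_span P Q w -> X w.
Proof.
move=> X0 XD X1 w [r [u [v [Pu Qv ->]]]].
by elim/big_ind: _ => // j _; apply: X1.
Qed.

End PairSpan.

Lemma pair_span_swap (T U : Type) (W : zmodType) (tau : T -> U -> W) P Q w :
  pair_span tau P Q w -> pair_span (fun u t => tau t u) Q P w.
Proof. by move=> [r [u [v [Pu Qv ->]]]]; exists r, v, u. Qed.

Section Reduction.
Variables (k : fieldType) (S S' : comAlgType k).
Variables (E : lmodType S) (E' : lmodType S') (W : zmodType).
Variable tau : E -> E' -> W.
Hypothesis tauDl : forall u u' v, tau (u + u') v = tau u v + tau u' v.
Hypothesis tauDr : forall u v v', tau u (v + v') = tau u v + tau u v'.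
Hypothesis tauZ : forall (c : k) u v, tau (c%:A *: u) v = tau u (c%:A *: v).

Definition k_free r (v : 'I_r -> E') :=
  forall c : 'I_r -> k, \sum_j (c j)%:A *: v j = 0 -> forall j, c j = 0.

(** A linear relation among the v_j eliminates one of them, at the expense of
    replacing the other u_j by linear combinations; hence an expression as a
    sum of pure tensors can be shortened until the v_j are independent. *)
Lemma pair_span_free (P : set E) (Q : set E') w :
  (forall (c : k) u u', P u -> P u' -> P (u + c%:A *: u')) ->
  pair_span tau P Q w ->
  exists r (u : 'I_r -> E) (v : 'I_r -> E'),
    [/\ forall j, P (u j), forall j, Q (v j), k_free v
      & w = \sum_j tau (u j) (v j)].
Proof.
move=> Pcl [r [u [v [Pu Qv ->]]]].
elim: r u v Pu Qv => [|r IH] u v Pu Qv.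
  by exists 0%N, u, v; split=> // c _ [].
have [fv|] := pselect (k_free v); first by exists r.+1, u, v.
move=> /existsNP[c] /not_implyP[c0 /existsNP[i /eqP ci]].
pose b l := - (c (lift i l) / c i).
have ev : v i = \sum_l (b l)%:A *: v (lift i l).
  have : (c i)^-1%:A *: (\sum_j (c j)%:A *: v j) = 0 by rewrite c0 scaler0.
  rewrite (bigD1_ord i) //= scalerDr scalerA -in_algE -[(c i)%:A]in_algE.
  rewrite -rmorphM mulVf // rmorph1 scale1r scaler_sumr => /eqP.
  rewrite addr_eq0 => /eqP ->.
  rewrite -sumrN; apply: eq_bigr => l _; rewrite scalerA -rmorphM -scaleNr.
  by rewrite -rmorphN /b mulrC.
have tau0 x : tau x 0 = 0.
  by apply: (addIr (tau x 0)); rewrite -tauDr !add0r.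
have tau_sum x n (F : 'I_n -> E') : tau x (\sum_l F l) = \sum_l tau x (F l).
  by apply: (big_morph (tau x)).
have [||r' [u' [v' [Pu' Qv' fv' e]]]] :=
  IH (fun l => u (lift i l) + (b l)%:A *: u i) (fun l => v (lift i l)).
- by move=> l; apply: Pcl.
- by move=> l.
exists r', u', v'; split=> //.
rewrite -e (bigD1_ord i) //= ev tau_sum -big_split.
by apply: eq_bigr => l _; rewrite tauDl tauZ addrC.
Qed.

End Reduction.

(** * Segre products *)

Section Segre.
Variables (k : fieldType) (d e : nat).
Notation SA := {mpoly k[d]}.
Notation SB := {mpoly k[e]}.
Notation SC := {mpoly k[d + e]}.

Definition prod_lr (a : SA) (b : SB) : SC := inj_left e a * inj_right d b.

(** Modules are submodules of free ones, so their tensor products live in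
    matrices over k[x, y]. *)
Definition tens p q (u : 'rV[SA]_p) (v : 'rV[SB]_q) : 'M[SC]_(p, q) :=
  \matrix_(i, j) prod_lr (u 0 i) (v 0 j).

Lemma prod_lrDl a a' b : prod_lr (a + a') b = prod_lr a b + prod_lr a' b.
Proof. by rewrite /prod_lr rmorphD mulrDl. Qed.
Lemma prod_lrDr a b b' : prod_lr a (b + b') = prod_lr a b + prod_lr a b'.
Proof. by rewrite /prod_lr rmorphD mulrDr. Qed.
Lemma prod_lrZl c a b : prod_lr (c *: a) b = c *: prod_lr a b.
Proof. by rewrite /prod_lr inj_leftZ -scalerAl. Qed.
Lemma prod_lrZr c a b : prod_lr a (c *: b) = c *: prod_lr a b.
Proof. by rewrite /prod_lr inj_rightZ -scalerAr. Qed.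
Lemma prod_lrM a b a' b' :
  prod_lr a b * prod_lr a' b' = prod_lr (a * a') (b * b').
Proof. by rewrite /prod_lr !rmorphM mulrACA. Qed.

Section Tens.
Variables p q : nat.
Implicit Types (u : 'rV[SA]_p) (v : 'rV[SB]_q).

Lemma tensDl u u' v : tens (u + u') v = tens u v + tens u' v.
Proof. by apply/matrixP=> i j; rewrite !mxE prod_lrDl. Qed.
Lemma tensDr u v v' : tens u (v + v') = tens u v + tens u v'.
Proof. by apply/matrixP=> i j; rewrite !mxE prod_lrDr. Qed.
Lemma tensZ (c : k) u v : tens (c%:A *: u) v = tens u (c%:A *: v).
Proof.
by apply/matrixP=> i j; rewrite !mxE !mulr_algl prod_lrZl prod_lrZr.
Qed.
Lemma tens_mull b u v (G : 'M[SA]_(p, b)) :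
  tens (u *m G) v = (map_mx (inj_left e) G)^T *m tens u v.
Proof.
apply/matrixP=> i j; rewrite !mxE /prod_lr rmorph_sum mulr_suml.
by apply: eq_bigr => l _; rewrite !mxE rmorphM /prod_lr mulrA [X in X * _]mulrC.
Qed.
Lemma tens_mulr b u v (H : 'M[SB]_(q, b)) :
  tens u (v *m H) = tens u v *m map_mx (@inj_right k d e) H.
Proof.
apply/matrixP=> i j; rewrite !mxE /prod_lr rmorph_sum mulr_sumr.
by apply: eq_bigr => l _; rewrite !mxE rmorphM /prod_lr mulrA.
Qed.
Lemma tens0l v : tens (0 : 'rV_p) v = 0.
Proof. by apply/matrixP=> i j; rewrite !mxE /prod_lr rmorph0 mul0r. Qed.
Lemma tens0r u : tens u (0 : 'rV_q) = 0.
Proof. by apply/matrixP=> i j; rewrite !mxE /prod_lr rmorph0 mulr0. Qed.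

Lemma tens_coef r (u : 'I_r -> 'rV[SA]_p) (v : 'I_r -> 'rV[SB]_q) :
  \sum_l tens (u l) (v l) = 0 ->
  forall i j m m', \sum_l (u l 0 i)@_m * (v l 0 j)@_m' = 0.
Proof.
move=> /matrixP H i j m m'; have := congr1 (mcoeff m \o coef_right m') (H i j).
rewrite /= summxE mxE !raddf_sum /= raddf0 mcoeff0 => E.
rewrite -[RHS]E; apply: eq_bigr => l _.
by rewrite mxE coef_right_prod mcoeffZ mulrC.
Qed.

Lemma tens_free_right r (u : 'I_r -> 'rV[SA]_p) (v : 'I_r -> 'rV[SB]_q) :
  k_free v -> \sum_l tens (u l) (v l) = 0 -> forall l, u l = 0.
Proof.
move=> fv /tens_coef H l; apply/rowP=> i; rewrite mxE; apply/mpolyP=> m.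
rewrite mcoeff0; apply: (fv (fun l => (u l 0 i)@_m)).
apply/rowP=> j; rewrite summxE mxE; apply/mpolyP=> m'; rewrite mcoeff0.
rewrite -[RHS](H i j m m') raddf_sum; apply: eq_bigr => l' _ /=.
by rewrite mxE mulr_algl mcoeffZ.
Qed.

Lemma tens_free_left r (u : 'I_r -> 'rV[SA]_p) (v : 'I_r -> 'rV[SB]_q) :
  k_free u -> \sum_l tens (u l) (v l) = 0 -> forall l, v l = 0.
Proof.
move=> fu /tens_coef H l; apply/rowP=> j; rewrite mxE; apply/mpolyP=> m'.
rewrite mcoeff0; apply: (fu (fun l => (v l 0 j)@_m')).
apply/rowP=> i; rewrite summxE mxE; apply/mpolyP=> m; rewrite mcoeff0.
rewrite -[RHS](H i j m m') raddf_sum; apply: eq_bigr => l' _ /=.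
by rewrite mxE mulr_algl mcoeffZ mulrC.
Qed.

End Tens.

(** Exactness of - (x) Q: write W with independent right factors; the map
    induced by G then kills each left factor. *)
Lemma tens_ker_left p q b (P : set 'rV[SA]_p) (Q : set 'rV[SB]_q)
    (G : 'M[SA]_(p, b)) W :
  (forall (c : k) u u', P u -> P u' -> P (u + c%:A *: u')) ->
  pair_span (@tens p q) P Q W -> (map_mx (inj_left e) G)^T *m W = 0 ->
  pair_span (@tens p q) (fun u => P u /\ u *m G = 0) Q W.
Proof.
move=> Pcl HW.
have := @pair_span_free k SA SB 'rV[SA]_p 'rV[SB]_q 'M[SC]_(p, q) (@tens p q)
  (@tensDl p q) (@tensDr p q) (@tensZ p q) P Q W Pcl HW.
move=> [r [u [v [Pu Qv fv ->]]]] W0; exists r, u, v; split=> // l; split=> //.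
move: l; apply: (tens_free_right fv); rewrite -[RHS]W0 mulmx_sumr.
by apply: eq_bigr => l _; rewrite tens_mull.
Qed.

Lemma tens_ker_right p q b (P : set 'rV[SA]_p) (Q : set 'rV[SB]_q)
    (H : 'M[SB]_(q, b)) W :
  (forall (c : k) v v', Q v -> Q v' -> Q (v + c%:A *: v')) ->
  pair_span (@tens p q) P Q W -> W *m map_mx (@inj_right k d e) H = 0 ->
  pair_span (@tens p q) P (fun v => Q v /\ v *m H = 0) W.
Proof.
move=> Qcl HW.
have := @pair_span_free k SB SA 'rV[SB]_q 'rV[SA]_p 'M[SC]_(p, q)
  (fun v u => tens u v) (fun v v' u => @tensDr p q u v v')
  (fun v u u' => @tensDl p q u u' v)
  (fun c v u => esym (@tensZ p q c u v)) Q P W Qcl (pair_span_swap HW).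
move=> [r [v [u [Qv Pu fu ->]]]] W0; exists r, u, v; split=> // l; split=> //.
move: l; apply: (tens_free_left fu); rewrite -[RHS]W0 mulmx_suml.
by apply: eq_bigr => l _; rewrite tens_mulr.
Qed.

Definition segre p q (M : nat -> set 'rV[SA]_p) (N : nat -> set 'rV[SB]_q)
    (n : nat) : set 'M[SC]_(p, q) :=
  pair_span (@tens p q) (M n) (N n).

Variables (grA : nat -> set SA) (grB : nat -> set SB).
Hypotheses (HA : graded_ring grA) (HB : graded_ring grB).

Definition segre_gr (n : nat) : set SC := pair_span prod_lr (grA n) (grB n).

Lemma graded_segre_gr : graded_ring segre_gr.
Proof.
split=> [i|f|i j f g Hf Hg].
- split=> [|c f g Hf Hg]; first exact: pair_span0.
  apply: pair_spanD => //; move: f Hf; apply: pair_span_ind.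
  + by rewrite scaler0; apply: pair_span0.
  + by move=> w w' Hw Hw'; rewrite scalerDr; apply: pair_spanD.
  + move=> a b Ha Hb; rewrite -prod_lrZl; apply: pair_span1 => //.
    exact: gr_scale.
- have Z c c' : prod_lr c%:A c'%:A = (c * c')%:A.
    by rewrite prod_lrZl prod_lrZr /prod_lr !rmorph1 mulr1 scalerA.
  split=> [|[c ->]]; last first.
    by rewrite -[c]mulr1 -Z; apply: pair_span1; apply: gr_const.
  move: f; apply: pair_span_ind.
  + by exists 0; rewrite scale0r.
  + by move=> _ _ [c ->] [c' ->]; exists (c + c'); rewrite scalerDl.
  by move=> _ _ /(gr_zero HA)[c ->] /(gr_zero HB)[c' ->]; exists (c * c').
move: f Hf; apply: pair_span_ind.
- by rewrite mul0r; apply: pair_span0.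
- by move=> w w' Hw Hw'; rewrite mulrDl; apply: pair_spanD.
move=> a b Ha Hb; move: g Hg; apply: pair_span_ind.
- by rewrite mulr0; apply: pair_span0.
- by move=> w w' Hw Hw'; rewrite mulrDr; apply: pair_spanD.
move=> a' b' Ha' Hb'; rewrite prod_lrM.
by apply: pair_span1; [exact: (gr_mul HA)|exact: (gr_mul HB)].
Qed.

Notation arow p := (fun n => @row_over k SA (grA n) p).
Notation brow q := (fun n => @row_over k SB (grB n) q).

Lemma graded_segre p q (M : nat -> set 'rV[SA]_p) (N : nat -> set 'rV[SB]_q) :
  graded_module grA M -> graded_module grB N ->
  graded_module segre_gr (segre M N).
Proof.
move=> HM HN.
split=> [n|n u v|m n f W Hf HW]; [exact: pair_span0|exact: pair_spanD|].
move: f Hf; apply: pair_span_ind.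
- by rewrite scale0r; apply: pair_span0.
- by move=> w w' Hw Hw'; rewrite scalerDl; apply: pair_spanD.
move=> a b Ha Hb; move: W HW; apply: pair_span_ind.
- by rewrite scaler0; apply: pair_span0.
- by move=> w w' Hw Hw'; rewrite scalerDr; apply: pair_spanD.
move=> u v Hu Hv.
have -> : prod_lr a b *: tens u v = tens (a *: u) (b *: v).
  by apply/matrixP=> i j; rewrite !mxE prod_lrM.
by apply: pair_span1; [exact: (gm_act HM)|exact: (gm_act HN)].
Qed.

(** The Segre product of two free modules is free over the Segre product of the
    rings. *)
Lemma segre_rows p q n (W : 'M[SC]_(p, q)) :
  segre (arow p) (brow q) n W <-> forall i j, segre_gr n (W i j).
Proof.
split=> [|H].
  move: W; apply: pair_span_ind => [i j|w w' Hw Hw' i j|u v Hu Hv i j].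
  - by rewrite mxE; apply: pair_span0.
  - by rewrite mxE; apply: pair_spanD; [exact: Hw|exact: Hw'].
  - by rewrite mxE; apply: pair_span1; [exact: Hu|exact: Hv].
rewrite [W]matrix_sum_delta.
apply: pair_span_sum => i; apply: pair_span_sum => j.
move: (W i j) (H i j); apply: pair_span_ind.
- by rewrite scale0r; apply: pair_span0.
- by move=> w w' Hw Hw'; rewrite scalerDl; apply: pair_spanD.
move=> a b Ha Hb.
have -> : prod_lr a b *: delta_mx i j =
    tens (a *: delta_mx 0 i : 'rV_p) (b *: delta_mx 0 j : 'rV_q).
  apply/matrixP=> i' j'; rewrite !mxE eqxx /=.
  by case: (i' == i); case: (j' == j); rewrite /= ?mulr1 ?mulr0 // /prod_lr
    ?rmorph0 ?mulr0 ?mul0r.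
apply: pair_span1; rewrite -[n]addn0.
  by apply: hrow_scale => //; apply: hrow_delta.
by apply: hrow_scale => //; apply: hrow_delta.
Qed.

Hypothesis HlinA : linear_mod grA (@positive_rows k SA grA 1).
Hypothesis HlinB : linear_mod grB (@positive_rows k SB grB 1).

(** The Segre product of a free module with N, given the previous stage of the
    induction.  It is covered by a free module over the Segre product of the
    rings, and the kernel of the cover is, after the shift, the Segre product
    of the positive part of the free module with the syzygies of N. *)
Lemma linear_segre_free_left i p q (N : nat -> set 'rV[SB]_q) :
  (forall q' (N' : nat -> set 'rV[SB]_q'), linear_mod grB N' ->
     linear_upto segre_gr i (segre (@positive_rows k SA grA p) N')) ->
  linear_mod grB N -> linear_upto segre_gr i.+1 (segre (arow p) N).
Proof.
move=> IH /(linear_modP HB)[c [H [fH lH]]]; set HM := \matrix_j H j.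
apply: (linear_upto_cover graded_segre_gr
  (F := fun n (W : 'M[SC]_(p, c)) => forall i j, segre_gr n (W i j))
  (g := mulmxr (map_mx (@inj_right k d e) HM))).
- split=> [n a b|n u v Hu Hv a b|m n f u Hf Hu a b]; rewrite mxE.
  + exact: pair_span0.
  + by apply: pair_spanD; [exact: Hu|exact: Hv].
  + exact: (gr_mul graded_segre_gr Hf (Hu a b)).
- move=> n W /=; split=> [|[V /segre_rows HV ->]].
    move: W; apply: pair_span_ind.
    + by exists 0; [move=> a b; rewrite mxE; apply: pair_span0|rewrite mul0mx].
    + move=> _ _ [u Hu ->] [v Hv ->]; exists (u + v); last by rewrite mulmxDl.
      by move=> a b; rewrite mxE; apply: pair_spanD; [exact: Hu|exact: Hv].
    move=> u v Hu /(fH.1)[v' Hv' ->]; exists (tens u v').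
      by apply/segre_rows; apply: pair_span1.
    by rewrite lincomb_matrix tens_mulr.
  move: V HV; apply: pair_span_ind.
  + by rewrite mul0mx; apply: pair_span0.
  + by move=> w w' Hw Hw'; rewrite mulmxDl; apply: pair_spanD.
  move=> u v Hu Hv; rewrite -tens_mulr -lincomb_matrix.
  by apply: pair_span1 => //; apply/(fH.1); exists v.
- move=> V /segre_rows HV /= V0.
  have [|r [u [v [Hu Hv ->]]]] := tens_ker_right _ HV V0.
    by move=> a u u' Hu Hu'; exact: (hrow_closed HB).
  rewrite big1 // => j _; have [vj vj0] := Hv j.
  by rewrite (fH.2 _ vj) ?tens0r // lincomb_matrix.
- exact: (@linear_free k SC segre_gr graded_segre_gr p c i.+1).
apply: eq_linear_upto (IH _ _ lH) => n V; split=> [HV|[/segre_rows HV V0]].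
  split.
    apply/segre_rows; move: V HV; apply: pair_span_ind.
    + exact: pair_span0.
    + exact: pair_spanD.
    by move=> u v Hu [Hv _]; apply: pair_span1.
  move: V HV => /=; apply: pair_span_ind.
  + by rewrite mul0mx.
  + by move=> w w' e1 e2; rewrite mulmxDl e1 e2 addr0.
  by move=> u v _ [_ v0]; rewrite -tens_mulr -lincomb_matrix v0 tens0r.
have [|r [u [v [Hu Hv ->]]]] := tens_ker_right _ HV V0.
  by move=> a u u' Hu Hu'; exact: (hrow_closed HB).
exists r, u, v; split=> // j; have [? ?] := Hv j; split=> //.
by rewrite lincomb_matrix.
Qed.

(** The kernel of the cover F o N -> M o N is, after the shift, the Segre
    product of the syzygies of M with the truncation of N. *)
Lemma linear_segre p q (M : nat -> set 'rV[SA]_p) (N : nat -> set 'rV[SB]_q) :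
  linear_mod grA M -> linear_mod grB N -> linear_mod segre_gr (segre M N).
Proof.
move=> HM HN i; elim: i p q M N HM HN => [//|i IH] p q M N HM HN.
have [c [G [fG lG]]] := linear_modP HA HM; set GM := \matrix_j G j.
have gN : graded_module grB N.
  by have [c' [H [fH _]]] := linear_modP HB HN; exact: (graded_free_gens HB fH).
have garow : graded_module grA (arow c).
  split=> [n|n u v|m n f u]; [exact: hrow_0|exact: hrow_add|].
  exact: hrow_scale.
apply: (linear_upto_cover graded_segre_gr
  (F := segre (arow c) N) (g := mulmx (map_mx (inj_left e) GM)^T)).
- exact: graded_segre.
- move=> n W /=; split=> [|[V HV ->]].
    move: W; apply: pair_span_ind.
    + by exists 0; [exact: pair_span0|rewrite mulmx0].
    + move=> _ _ [u Hu ->] [v Hv ->]; exists (u + v); last by rewrite mulmxDr.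
      exact: pair_spanD.
    move=> u v /(fG.1)[u' Hu' ->] Hv.
    exists (tens u' v); first exact: pair_span1.
    by rewrite lincomb_matrix tens_mull.
  move: V HV; apply: pair_span_ind.
  + by rewrite mulmx0; apply: pair_span0.
  + by move=> w w' Hw Hw'; rewrite mulmxDr; apply: pair_spanD.
  move=> u v Hu Hv; rewrite -tens_mull -lincomb_matrix.
  by apply: pair_span1 => //; apply/(fG.1); exists u.
- move=> V HV /= V0.
  have [|r [u [v [Hu Hv ->]]]] := tens_ker_left _ HV V0.
    by move=> a u u' Hu Hu'; exact: (hrow_closed HA).
  rewrite big1 // => j _; have [uj uj0] := Hu j.
  by rewrite (fG.2 _ uj) ?tens0l // lincomb_matrix.
- apply: linear_segre_free_left HN => q' N' HN'.
  by apply: IH HN'; apply: linear_positive_rows.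
apply: eq_linear_upto (IH _ _ _ _ lG (linear_truncation HB HlinB HN)) => n V.
split=> [HV|[HV V0]].
  split.
    move: V HV; apply: pair_span_ind.
    + exact: pair_span0.
    + exact: pair_spanD.
    by move=> u v [Hu _] Hv; apply: pair_span1.
  move: V HV => /=; apply: pair_span_ind.
  + by rewrite mulmx0.
  + by move=> w w' e1 e2; rewrite mulmxDr e1 e2 addr0.
  by move=> u v [_ u0] _; rewrite -tens_mull -lincomb_matrix u0 tens0l.
have [|r [u [v [Hu Hv ->]]]] := tens_ker_left _ HV V0.
  by move=> a u u' Hu Hu'; exact: (hrow_closed HA).
exists r, u, v; split=> // j; have [? ?] := Hu j; split=> //.
by rewrite lincomb_matrix.
Qed.

Lemma linear_segre_positive :
  linear_mod segre_gr (@positive_rows k SC segre_gr 1).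
Proof.
move=> i; apply: eq_linear_upto (linear_segre HlinA HlinB i) => n W.
split=> [H j|H]; first exact: ((@segre_rows 1 1 n.+1 W).1 H 0 j).
by apply: (@segre_rows 1 1 n.+1 W).2 => a b; rewrite (ord1 a); apply: H.
Qed.

End Segre.

(** * Adjoining a variable *)

Section Upto.
Variables (E : zmodType) (M : nat -> set E).

(** The component of degree n of M[t], for a variable t of degree 1, after
    setting t = 1.  When the M_i are independent, an element together with its
    degree n determines the element of M[t]. *)
Definition upto (n : nat) : set E := fun u =>
  exists g : nat -> E, (forall i, M i (g i)) /\ u = \sum_(i < n.+1) g i.

Definition independent_mod : Prop := forall n (g : nat -> E),
  (forall i, M i (g i)) -> \sum_(i < n) g i = 0 ->
  forall i, (i < n)%N -> g i = 0.

Lemma upto_zero u : upto 0 u -> M 0%N u.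
Proof. by move=> [g [Hg ->]]; rewrite big_ord1. Qed.

Hypothesis M0 : forall n, M n 0.
Hypothesis MD : forall n u v, M n u -> M n v -> M n (u + v).

Lemma upto_one n i u : (i <= n)%N -> M i u -> upto n u.
Proof.
move=> ilen Mu; exists (fun j => if j == i then u else 0); split=> [j|].
  by case: eqP => [->|_].
rewrite (bigD1 (Ordinal (ilen : (i < n.+1)%N))) //= eqxx big1 ?addr0 // => j.
by rewrite -val_eqE => /negPf ->.
Qed.

Lemma upto_0 n : upto n 0. Proof. exact: (upto_one (leq0n n)). Qed.

Lemma upto_add n u v : upto n u -> upto n v -> upto n (u + v).
Proof.
move=> [g [Hg ->]] [h [Hh ->]]; exists (fun i => g i + h i).
by split=> [i|]; [exact: MD|rewrite big_split].
Qed.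

Lemma upto_sum n I (s : seq I) (F : I -> E) :
  (forall i, upto n (F i)) -> upto n (\sum_(i <- s) F i).
Proof.
by move=> H; elim/big_ind: _ => // [|x y]; [exact: upto_0|exact: upto_add].
Qed.

Lemma upto_mono m n u : (m <= n)%N -> upto m u -> upto n u.
Proof.
move=> mn [g [Hg ->]]; apply: upto_sum => i; apply: upto_one (Hg i).
by apply: leq_trans mn; rewrite -ltnS.
Qed.

End Upto.

Section Rees.
Variables (k : fieldType) (S : comAlgType k) (gr : nat -> set S).
Hypothesis Hgr : graded_ring gr.
Hypothesis Hind : independent gr.

Notation up := (upto gr).
Notation hrow n v := (row_over (gr n) v).
Notation urow n v := (row_over (up n) v).

Lemma up_add n f g : up n f -> up n g -> up n (f + g).
Proof. by apply: upto_add => i u v; apply: gr_add. Qed.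

Lemma up_one n i f : (i <= n)%N -> gr i f -> up n f.
Proof. by apply: upto_one => j; apply: gr_0. Qed.

Lemma graded_upto : graded_ring up.
Proof.
split=> [n|f|i j f g [a [Ha ->]] [b [Hb ->]]].
- split=> [|c f g [a [Ha ->]]]; first by apply: up_one (leq0n n) (gr_0 Hgr 0).
  apply: up_add; exists (fun i => c *: a i).
  split=> [i|]; first exact: gr_scale.
  by rewrite scaler_sumr.
- rewrite -(gr_zero Hgr); split; first exact: upto_zero.
  by apply: up_one.
rewrite mulr_suml.
apply: upto_sum => [n|n u v|x]; [exact: gr_0|exact: gr_add|].
rewrite mulr_sumr.
apply: upto_sum => [n|n u v|y]; [exact: gr_0|exact: gr_add|].
apply: up_one (gr_mul Hgr (Ha x) (Hb y)).
by apply: leq_add; rewrite -ltnS.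
Qed.

Lemma upto_rows c n (v : 'rV[S]_c) :
  urow n v <-> upto (fun i => @row_over k S (gr i) c) n v.
Proof.
split=> [/choice[g Hg]|[g [Hg ->]] j].
  exists (fun i => \row_j g j i); split=> [i j|].
    by rewrite mxE; case: (Hg j).
  apply/rowP=> j; have [_ ->] := Hg j; rewrite summxE.
  by apply: eq_bigr => i _; rewrite mxE.
exists (fun i => g i 0 j); split=> [i|]; first exact: Hg.
by rewrite summxE.
Qed.

Notation pos := (@positive_rows k S gr _).

Lemma independent_pos c : independent_mod (@positive_rows k S gr c).
Proof.
move=> n g Hg g0 i lin; apply/rowP=> j; rewrite mxE.
pose h l := if l is l'.+1 then g l' 0 j else 0.
apply: (Hind (n := n.+1) (g := h) _ _ (i := i.+1)) => //.
  by case=> [|l] /=; [exact: gr_0|exact: Hg].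
move/rowP/(_ j): g0; rewrite summxE mxE => e0.
rewrite big_ord_recl /= add0r -[RHS]e0.
by apply: eq_bigr.
Qed.

Lemma independent_syzygy (E : lmodType S) c (G : 'I_c -> E) :
  independent_mod (syzygy gr G).
Proof.
by move=> n g Hg; apply: independent_pos => i; case: (Hg i).
Qed.

(** The components of a syzygy over gr[t] are syzygies over gr, as M is a direct
    sum.  The component of degree 0 of the coefficients vanishes by minimality
    of [G], which is why the shifted degrees agree. *)
Lemma syzygy_upto (E : lmodType S) (M : nat -> set E) c (G : 'I_c -> E) n v :
  free_gens gr M G -> independent_mod M ->
  syzygy up G n v <-> upto (syzygy gr G) n v.
Proof.
move=> fG indM; split=> [[/upto_rows[g [Hg ->]]]|[g [Hg ->]]]; last first.
  split.
    apply/upto_rows; exists (fun i => if i is i'.+1 then g i' else 0).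
    split=> [[|i]|]; [exact: hrow_0|by case: (Hg i)|].
    by rewrite [RHS]big_ord_recl /= add0r; apply: eq_bigr.
  by rewrite lincomb_sum big1 // => i _; case: (Hg i).
rewrite lincomb_sum => g0.
have gG0 i : (i < n.+2)%N -> lincomb (g i) G = 0.
  apply: (indM n.+2 (fun i => lincomb (g i) G)) => // l.
  by apply/(fG.1); exists (g l).
exists (fun i => if (i < n.+1)%N then g i.+1 else 0); split=> [i|].
  case: ifP => [ilt|_]; last by split; [exact: hrow_0|rewrite lincomb0].
  by split; [exact: Hg|apply: gG0].
rewrite big_ord_recl (fG.2 (g 0%N)) ?gG0 // add0r.
by apply: eq_bigr => i _; rewrite /= ltn_ord.
Qed.

Lemma free_gens_upto (E : lmodType S) (M : nat -> set E) c (G : 'I_c -> E) :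
  free_gens gr M G -> free_gens up (upto M) G.
Proof.
move=> fG; split=> [n u|v Hv]; last first.
  by apply: (fG.2) => j; apply: upto_zero; apply: Hv.
split=> [[g [Hg ->]]|[v /upto_rows[g [Hg ->]] ->]]; last first.
  exists (fun i => lincomb (g i) G); split=> [i|]; last by rewrite lincomb_sum.
  by apply/(fG.1); exists (g i).
have /choice[h Hh] : forall i, exists v : 'rV[S]_c,
    hrow i v /\ g i = lincomb v G.
  by move=> i; have /(fG.1)[v] := Hg i; exists v.
exists (\sum_(i < n.+1) h i).
  by apply/upto_rows; exists h; split=> // i; case: (Hh i).
by rewrite lincomb_sum; apply: eq_bigr => i _; case: (Hh i).
Qed.

(** The extension of scalars from gr to gr[t] is exact, and takes generators to
    generators. *)
Lemma linear_upto_rees i (E : lmodType S) (M : nat -> set E) :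
  independent_mod M -> linear_upto gr i M -> linear_upto up i (upto M).
Proof.
elim: i E M => [//|i IH] E M indM [c [G [fG lG]]]; exists c, G.
split; first exact: free_gens_upto.
have H := IH _ _ (@independent_syzygy _ _ G) lG.
apply: eq_linear_upto H => n v.
by rewrite (syzygy_upto _ _ fG).
Qed.

Lemma pos_add c n (u v : 'rV[S]_c) : pos n u -> pos n v -> pos n (u + v).
Proof. exact: hrow_add. Qed.

Lemma urowS p n (w : 'rV[S]_p) :
  urow n.+1 w <-> exists c w', [/\ hrow 0%N c, upto pos n w' & w = c + w'].
Proof.
split=> [/upto_rows[g [Hg ->]]|[c [w' [Hc [g [Hg ->]] ->]]]].
  rewrite big_ord_recl; exists (g 0%N), (\sum_(i < n.+1) g i.+1).
  by split=> //; exists (fun i => g i.+1); split=> // i; apply: Hg.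
apply/upto_rows; exists (fun i => if i is i'.+1 then g i' else c).
split=> [[|i]|]; [exact: Hc|exact: Hg|].
by rewrite [RHS]big_ord_recl.
Qed.

Lemma const_pos_direct p n (c w : 'rV[S]_p) :
  hrow 0%N c -> upto pos n w -> c + w = 0 -> c = 0.
Proof.
move=> Hc [g [Hg ->]] e; apply/rowP=> j; rewrite mxE.
pose h l := if l is l'.+1 then g l' 0 j else c 0 j.
apply: (Hind (n := n.+2) (g := h) _ _ (i := 0%N)) => //.
  by case=> [|l] /=; [exact: Hc|exact: Hg].
move/rowP/(_ j): e; rewrite !mxE summxE => e0.
rewrite big_ord_recl /= -[RHS]e0.
by congr (_ + _); apply: eq_bigr.
Qed.

Hypothesis Hlin : linear_mod gr (@positive_rows k S gr 1).

(** The generators are 1, which stands for t, and generators G of the positive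
    ideal of gr.  The coefficient of 1 in a syzygy has no constant term, since
    it is a combination of G; and each element of pos[t] occurs, being itself
    such a combination. *)
Lemma linear_rees_positive : linear_mod up (@positive_rows k S up 1).
Proof.
have [p [G [fG lG]]] := linear_modP Hgr Hlin.
have fuG := free_gens_upto fG; have Hup := graded_upto.
pose D (j : 'I_1) : 'rV[S]_1 := delta_mx 0 j.
have DE c : lincomb c D = c by rewrite /lincomb -row_sum_delta.
have urow_mono m n c (v : 'rV[S]_c) : (m <= n)%N -> urow m v -> urow n v.
  move=> mn Hv j.
  by apply: upto_mono mn (Hv j) => [l|l a b]; [exact: gr_0|exact: gr_add].
have hrow_up n c (v : 'rV[S]_c) : hrow 0%N v -> urow n v.
  by move=> Hv j; apply: up_one (Hv j).
have pos_up n (w : 'rV[S]_1) : upto pos n w -> urow n.+1 w.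
  move=> Hw; apply/urowS; exists 0, w; rewrite add0r; split=> //.
  exact: hrow_0.
case=> [//|i] /=; exists (1 + p)%N, (cat_fam D G).
split; first split.
- move=> n u; split=> [/urowS[c [w [Hc /(fuG.1)[v Hv ->] ->]]]|[v]].
    exists (row_mx c v); last by rewrite lincomb_cat DE.
    by apply/hrow_cat; split=> //; apply: hrow_up.
  rewrite -[v]hsubmxK => /hrow_cat[Hl Hr] ->; rewrite lincomb_cat DE.
  apply: (hrow_add Hup); first exact: urow_mono Hl.
  by apply: pos_up; apply/(fuG.1); exists (rsubmx v).
- move=> v; rewrite -[v]hsubmxK => /hrow_cat[Hl Hr].
  rewrite lincomb_cat DE => e.
  have Hl0 : hrow 0%N (lsubmx v) by move=> j; apply: upto_zero; apply: Hl.
  have posr : upto pos 0 (lincomb (rsubmx v) G).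
    by apply/(fuG.1); exists (rsubmx v).
  have l0 := const_pos_direct Hl0 posr e.
  move: e; rewrite l0 add0r => /(fuG.2) -> //; exact: row_mx0.
have lX : linear_upto up i (syzygy up G).
  have H := linear_upto_rees (@independent_syzygy _ _ G) (lG i).
  apply: eq_linear_upto H => n v.
  by rewrite (syzygy_upto _ _ fG (@independent_pos 1)).
have lZ : linear_upto up i (upto (@positive_rows k S gr 1)) :=
  linear_upto_rees (@independent_pos 1) (Hlin i).
apply: (linear_upto_ext Hup (f := mulmxr (row_mx 0 1%:M : 'M[S]_(p, 1 + p)))
  (g := mulmxr (col_mx 1%:M 0 : 'M[S]_(1 + p, 1)))
  (graded_syzygy Hup _) _ lX lZ).
split=> [n u [Hu u0]|n u _|n u _|n v|n w] /=; rewrite ?mulmx_inr ?mulmx_projl.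
- split; first by apply/hrow_cat; split=> //; apply: hrow_0.
  by rewrite lincomb_cat lincomb0 add0r.
- by move=> /(congr1 rsubmx); rewrite row_mxKr linear0.
- by rewrite row_mxKl.
- rewrite -[v]hsubmxK => -[/hrow_cat[_ Hr] e]; rewrite row_mxKl => l0.
  exists (rsubmx v); last by rewrite mulmx_inr l0.
  by split=> //; move: e; rewrite l0 lincomb_cat lincomb0 add0r.
split=> [Hw|[v]].
  have /(fuG.1)[v Hv ew] := Hw.
  exists (row_mx w (- v)); last by rewrite mulmx_projl row_mxKl.
  split; last by rewrite lincomb_cat DE lincombN -ew subrr.
  apply/hrow_cat; split; first exact: pos_up.
  by apply: hrow_opp => //; apply: urow_mono Hv.
rewrite mulmx_projl -[v]hsubmxK row_mxKl.
move=> [/hrow_cat[/urowS[c [w' [Hc Hw' ew]]] Hr]].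
rewrite lincomb_cat DE => + ->.
have posr : upto pos n.+1 (lincomb (rsubmx v) G).
  by apply/(fuG.1); exists (rsubmx v).
have Hw1 : upto pos n.+1 w'.
  by apply: upto_mono (leqnSn n) Hw' => [l|]; [exact: hrow_0|exact: pos_add].
rewrite ew -addrA => /(const_pos_direct Hc (upto_add (@pos_add _) Hw1 posr)) ->.
by rewrite add0r.
Qed.

End Rees.

(** * Koszul algebras and linear modules *)

Section FamilySum.
Variables (k : fieldType) (S : comAlgType k) (M : nat -> set S).
Hypothesis M0 : forall i, M i 0.
Hypothesis MD : forall i u v, M i u -> M i v -> M i (u + v).

Lemma family_sum_upto f : sum_of M f <-> exists n, upto M n f.
Proof.
split=> [[n [g [Hg ->]]]|[n [g [Hg ->]]]]; last by exists n.+1, g.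
exists n; apply: upto_sum => // i.
by apply: upto_one (Hg i) => //; apply: ltnW.
Qed.

Lemma family_sum_one i f : M i f -> sum_of M f.
Proof. by move=> Hf; apply/family_sum_upto; exists i; apply: upto_one Hf. Qed.

Lemma family_sum_add f g : sum_of M f -> sum_of M g -> sum_of M (f + g).
Proof.
move=> /family_sum_upto[m Hf] /family_sum_upto[n Hg]; apply/family_sum_upto.
exists (m + n)%N; apply: (upto_add MD).
  exact: (upto_mono M0 MD (leq_addr _ _) Hf).
exact: (upto_mono M0 MD (leq_addl _ _) Hg).
Qed.

Lemma family_sum_sum I (s : seq I) (F : I -> S) :
  (forall i, sum_of M (F i)) -> sum_of M (\sum_(i <- s) F i).
Proof.
move=> H; elim/big_ind: _ => // [|x y]; last exact: family_sum_add.
exact: family_sum_one (M0 0).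
Qed.

End FamilySum.

Section SumOf.
Variables (k : fieldType) (S : comAlgType k) (gr : nat -> set S).
Hypothesis Hgr : graded_ring gr.

Lemma sum_of_upto f : sum_of gr f <-> exists n, upto gr n f.
Proof. exact: (family_sum_upto (gr_0 Hgr) (gr_add Hgr)). Qed.

Lemma sum_of_one i f : gr i f -> sum_of gr f.
Proof. exact: (family_sum_one (gr_0 Hgr) (gr_add Hgr)). Qed.

Lemma sum_of_add f g : sum_of gr f -> sum_of gr g -> sum_of gr (f + g).
Proof. exact: (family_sum_add (gr_0 Hgr) (gr_add Hgr)). Qed.

Lemma sum_of_sum I (s : seq I) (F : I -> S) :
  (forall i, sum_of gr (F i)) -> sum_of gr (\sum_(i <- s) F i).
Proof. exact: (family_sum_sum (gr_0 Hgr) (gr_add Hgr)). Qed.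

Lemma sum_of_mul f g : sum_of gr f -> sum_of gr g -> sum_of gr (f * g).
Proof.
move=> [m [a [Ha ->]]] [n [b [Hb ->]]]; rewrite mulr_suml.
apply: sum_of_sum => i; rewrite mulr_sumr; apply: sum_of_sum => j.
exact: sum_of_one (gr_mul Hgr (Ha i) (Hb j)).
Qed.

Lemma sum_of_scale (c : k) f : sum_of gr f -> sum_of gr (c *: f).
Proof.
by rewrite -mulr_algl; apply: sum_of_mul (sum_of_one (gr_const Hgr c)).
Qed.

Lemma sum_of_subalgebra : is_subalgebra (sum_of gr).
Proof.
split; [split| |exact: sum_of_mul].
- exact: sum_of_one (gr_0 Hgr 0).
- by move=> c u v Hu Hv; apply: sum_of_add => //; apply: sum_of_scale.
- exact: sum_of_one (gr_1 Hgr).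
Qed.

Lemma row_over_sum_of c (v : 'rV[S]_c) :
  row_over (sum_of gr) v <->
  exists n, upto (fun i => @row_over k S (gr i) c) n v.
Proof.
split=> [Hv|[n /(upto_rows gr) Hv] j]; last first.
  by apply/sum_of_upto; exists n; apply: Hv.
have /choice[n Hn] : forall j, exists n, upto gr n (v 0 j).
  by move=> j; apply/sum_of_upto.
exists (\max_j n j)%N; apply/(upto_rows gr) => j.
apply: upto_mono (Hn j); [exact: gr_0|by move=> *; apply: gr_add|].
exact: leq_bigmax.
Qed.

Hypothesis Hind : independent gr.
Notation hrow n v := (row_over (gr n) v).

(** Comparing the terms of degree m + 1, the sum being direct. *)
Lemma component c (u : 'rV[S]_c) n m (w : nat -> 'rV[S]_c) :
  hrow m.+1 u -> (forall l, hrow l.+1 (w l)) -> u = \sum_(l < n) w l ->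
  u = if (m < n)%N then w m else 0.
Proof.
move=> Hu Hw e.
pose g l := (if (l < n)%N then w l else 0) - (if l == m then u else 0).
have Hg l : positive_rows gr l (g l).
  apply: hrow_add => //; first by case: ifP => // _; apply: hrow_0.
  apply: hrow_opp => //; case: eqP => [->|_] //; exact: hrow_0.
have : g m = 0.
  apply: (independent_pos Hgr Hind (n := (n + m.+1)%N) Hg); last first.
    exact: leq_addl.
  rewrite big_split /= sumrN.
  have -> : \sum_(l < n + m.+1) (if (l < n)%N then w l else 0) = u.
    rewrite e big_split_ord /= [X in _ + X]big1 ?addr0.
      by apply: eq_bigr => l _; rewrite ltn_ord.
    by move=> l _; rewrite ltnNge leq_addr.
  have lt : (m < n + m.+1)%N by exact: leq_addl.
  rewrite (bigD1 (Ordinal lt)) //= eqxx big1 ?addr0 ?subrr // => l.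
  by rewrite -val_eqE => /negPf ->.
by rewrite /g eqxx => /eqP; rewrite subr_eq0 => /eqP <-.
Qed.

End SumOf.

Section LinearOfKoszul.
Variables (k : fieldType) (S : comAlgType k) (A : set S) (gr : nat -> set S).
Hypothesis HA : koszul A gr.

Lemma koszul_graded_ring : graded_ring gr.
Proof.
have [[H1 _ _ H0 HM _] _] := HA; split=> // f; rewrite H0.
by split=> [[c _ <-]|[c ->]]; exists c.
Qed.

Lemma koszul_independent : independent gr.
Proof. by case: HA => -[]. Qed.

Notation Hgr := koszul_graded_ring.
Notation Hind := koszul_independent.
Notation hrow n v := (row_over (gr n) v).

(** Each image of a differential is linear: the rows of the matrix are its
    generators, and exactness identifies their syzygies with the image of the
    next differential.  The given exactness concerns rows with entries in A;
    comparison of components reduces it to homogeneous ones. *)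
Lemma koszul_linear : linear_mod gr (@positive_rows k S gr 1).
Proof.
have [[_ HS _ _ _ _] [b [M [M1 M0 Mex]]]] := HA.
pose I i n (u : 'rV[S]_(res_rank b i)) :=
  exists2 v : 'rV[S]_(res_rank b i.+1), hrow n v & u = v *m M i.
have M1h i n (v : 'rV[S]_(res_rank b i.+1)) : hrow n v -> hrow n.+1 (v *m M i).
  by rewrite -(addn1 n) => Hv; apply: (hrow_mul Hgr Hv) => ? ?; apply: M1.
have compM i n (u : 'rV[S]_(res_rank b i)) (v : 'rV[S]_(res_rank b i.+1)) :
    hrow n.+1 u -> row_over A v -> u = v *m M i -> I i n u.
  rewrite HS => Hu /(row_over_sum_of Hgr)[N [w [Hw ->]]].
  rewrite mulmx_suml => e.
  have := component Hgr Hind (w := fun l => w l *m M i) Hu _ e.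
  case: ifP => _ -> //.
  - by exists (w n).
  - by move=> l; apply: M1h.
  - by exists 0; rewrite ?mul0mx //; apply: hrow_0 Hgr _ _.
  - by move=> l; apply: M1h.
have rowA n c (v : 'rV[S]_c) : hrow n v -> row_over A v.
  by move=> Hv j; rewrite HS; apply: sum_of_one (Hv j); apply: Hgr.
have I0 n u : positive_rows gr n u <-> I 0%N n u.
  split=> [Hu|[v Hv ->]]; last exact: M1h.
  have [v Hv e] : exists2 v : 'rV[S]_(res_rank b 1),
      row_over A v & u = v *m M 0%N.
    apply/M0; exists n.+1, (fun l => if l == n then u 0 0 else 0).
    split=> [i|]; first by case: eqP => [->|_]; [exact: Hu|apply: gr_0 Hgr _].
    rewrite (bigD1 (@Ordinal n.+1 n (leqnn _))) //= eqxx big1 ?addr0 // => l.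
    by rewrite -val_eqE => /negPf ->.
  exact: compM Hu Hv e.
have lE i v : lincomb v (fun r => row r (M i)) = v *m M i.
  by rewrite lincomb_rows.
have syzI i n v : I i.+1 n v <-> syzygy gr (fun r => row r (M i)) n v.
  split=> [[w Hw ->]|[Hv]].
    split; first exact: M1h.
    rewrite lE; apply/Mex; first by apply: rowA; apply: M1h Hw.
    by exists w => //; apply: rowA Hw.
  rewrite lE => /Mex[|w Hw e]; first exact: rowA Hv.
  exact: compM Hv Hw e.
have fI i : free_gens gr (I i) (fun r => row r (M i)).
  split=> [n u|v Hv].
    by split=> -[v Hv ->]; exists v; rewrite ?lE.
  rewrite lE => /Mex[|w]; first exact: rowA Hv.
  rewrite HS => /(row_over_sum_of Hgr)[N [g [Hg ->]]] e.
  have up : upto (@positive_rows k S gr _) N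
      (- (\sum_(l < N.+1) g l *m M i.+1)).
    exists (fun l => - (g l *m M i.+1)); split=> [l|]; last by rewrite sumrN.
    by apply: hrow_opp Hgr _ _ _ _; apply: M1h.
  apply: (const_pos_direct Hind Hv up).
  by rewrite {1}e mulmx_suml subrr.
suff lI j i : linear_upto gr j (I i).
  by move=> j; apply: eq_linear_upto (lI j 0%N) => n u; rewrite I0.
elim: j i => [//|j IH] i /=; exists _, (fun r => row r (M i)); split=> //.
by apply: eq_linear_upto (IH i.+1) => n v; rewrite syzI.
Qed.

End LinearOfKoszul.

Section KoszulOfLinear.
Variables (k : fieldType) (S : comAlgType k) (gr : nat -> set S).
Hypothesis Hgr : graded_ring gr.
Hypothesis Hind : independent gr.
Hypothesis Hlin : linear_mod gr (@positive_rows k S gr 1).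
Notation hrow n v := (row_over (gr n) v).

(** Generation in degree 1 is part of the linearity of the positive ideal. *)
Lemma standard_graded_of_linear : standard_graded (sum_of gr) gr.
Proof.
split; [exact: gr_subspace Hgr|by []|exact: Hind| |exact: gr_mul Hgr|].
  apply/predeqP => f; rewrite (gr_zero Hgr).
  by split=> [[c ->]|[c _ <-]]; exists c.
apply/predeqP => f; split=> [[n [g [Hg ->]]] B HB1 HB|]; last first.
  by apply; [exact: sum_of_subalgebra|move=> x Hx; apply: sum_of_one Hx].
have [[B0 Blin] B1 BM] := HB1.
have BD u v : B u -> B v -> B (u + v).
  by move=> Hu Hv; rewrite -[u]scale1r; apply: Blin.
suff grB i x : gr i x -> B x by elim/big_ind: _ => // j _; apply: grB (Hg j).
elim: i x => [|i IH] x Hx.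
  by move: Hx => /(gr_zero Hgr)[c ->]; rewrite -[_%:A]addr0; apply: Blin.
have [c [G [fG _]]] := Hlin 1%N.
have /(fG.1)[v Hv /rowP/(_ 0)] : positive_rows gr i (x%:M : 'rV[S]_1).
  by move=> j; rewrite (ord1 j) mxE eqxx mulr1n.
rewrite mxE eqxx mulr1n /lincomb summxE => ->.
elim/big_ind: _ => // j _; rewrite mxE; apply: BM; first exact: IH (Hv j).
exact: HB (free_gens_in Hgr j fG 0).
Qed.

Definition linear_syzygies p q (G : 'M[S]_(p, q)) :=
  linear_mod gr (syzygy gr (fun r => row r G)).

(** Stated for every matrix, with the hypothesis inside the existential, so that
    the choice of the next differential is a total function. *)
Lemma next_syzygy p q (G : 'M[S]_(p, q)) :
  exists x : {p' & 'M[S]_(p', p)}, linear_syzygies G ->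
    free_gens gr (syzygy gr (fun r => row r G)) (fun r => row r (projT2 x)) /\
    linear_syzygies (projT2 x).
Proof.
have [lG|nlG] := pselect (linear_syzygies G); last first.
  by exists (existT _ 0%N (0 : 'M[S]_(0, p))).
have [c [H [fH lH]]] := linear_modP Hgr lG.
exists (existT _ c (\matrix_j H j)) => _ /=.
have eH : (fun r => row r (\matrix_j H j)) = H.
  by apply/funext => r; rewrite rowK.
by rewrite /linear_syzygies eH.
Qed.

Definition next p q (G : 'M[S]_(p, q)) : {p' & 'M[S]_(p', p)} :=
  projT1 (cid (next_syzygy G)).

Section Resolution.
Variables (p0 : nat) (G0 : 'M[S]_(p0, 1)).

(** The i-th differential together with its dimensions.  Carrying them along
    avoids casts: the target of each differential is the source of the previous
    one by computation. *)
Fixpoint stage (i : nat) : {p & {q & 'M[S]_(p, q)}} :=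
  if i is i'.+1 then
    let x := next (projT2 (projT2 (stage i'))) in
    existT _ (projT1 x) (existT _ (projT1 (stage i')) (projT2 x))
  else existT _ p0 (existT _ 1%N G0).

Definition betti i := projT1 (stage i).

(** The i-th differential again, at the type that a linear resolution
    expects. *)
Definition differential (i : nat) :
    'M[S]_(res_rank betti i.+1, res_rank betti i) :=
  match i with
  | 0 => G0
  | i'.+1 => projT2 (next (projT2 (projT2 (stage i'))))
  end.

Hypothesis fG0 : free_gens gr (@positive_rows k S gr 1) (fun r => row r G0).
Hypothesis lG0 : linear_syzygies G0.

Lemma stage_linear i : linear_syzygies (projT2 (projT2 (stage i))).
Proof.
elim: i => [//|i IH] /=; rewrite /next.
by case: cid => x /= /(_ IH)[].
Qed.

Lemma differentialS i :
  free_gens gr (syzygy gr (fun r => row r (differential i)))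
  (fun r => row r (differential i.+1)).
Proof.
have key : free_gens gr (syzygy gr (fun r => row r (projT2 (projT2 (stage i)))))
    (fun r => row r (projT2 (next (projT2 (projT2 (stage i)))))).
  by rewrite /next; case: cid => x /= /(_ (stage_linear i))[].
by case: i key.
Qed.

Lemma differential_deg1 i r c : gr 1%N (differential i r c).
Proof.
case: i r c => [|i] r c.
  by have := free_gens_in Hgr r fG0 c; rewrite mxE.
by have [/(_ c)] := free_gens_in Hgr r (differentialS i); rewrite mxE.
Qed.

Lemma differential_inj i (v : 'rV[S]_(res_rank betti i.+1)) :
  hrow 0%N v -> v *m differential i = 0 -> v = 0.
Proof.
rewrite -lincomb_rows; case: i v => [|i] v; first exact: (fG0.2).
exact: ((differentialS i).2).
Qed.

Lemma linear_resolution_differential :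
  linear_resolution (sum_of gr) gr differential.
Proof.
have M1h i n (v : 'rV[S]_(res_rank betti i.+1)) :
    hrow n v -> hrow n.+1 (v *m differential i).
  rewrite -(addn1 n) => Hv; apply: (hrow_mul Hgr Hv) => ? ?.
  exact: differential_deg1.
split=> [|u|i u].
- exact: differential_deg1.
- split=> [[n [g [Hg e]]]|]; last first.
    move=> [v /(row_over_sum_of Hgr)[n [w [Hw ->]]] ->].
    exists n.+1, (fun l => (w l *m differential 0) 0 0); split=> [l|].
      exact: M1h.
    by rewrite mulmx_suml summxE.
  have /choice[v Hv] : forall l, exists v : 'rV[S]_(res_rank betti 1),
      hrow l v /\ (g l)%:M = v *m differential 0.
    move=> l; have /(fG0.1)[v Hv ev] : positive_rows gr l ((g l)%:M : 'rV[S]_1).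
      by move=> j; rewrite (ord1 j) mxE eqxx mulr1n.
    by exists v; split=> //; rewrite ev lincomb_rows.
  exists (\sum_(l < n) v l).
    move=> j; rewrite summxE; apply: sum_of_sum => // l.
    by apply: sum_of_one => //; case: (Hv l) => /(_ j) H _; exact: H.
  rewrite mulmx_suml; apply/rowP=> j; rewrite (ord1 j) e summxE.
  by apply: eq_bigr => l _; case: (Hv l) => _ <-; rewrite mxE eqxx mulr1n.
have M0 : differential i.+1 *m differential i = 0.
  apply/row_matrixP => r; rewrite row_mul row0.
  by have [_] := free_gens_in Hgr r (differentialS i); rewrite lincomb_rows.
move=> Hu; split=> [u0|[v _ ->]]; last by rewrite -mulmxA M0 mulmx0.
have /(row_over_sum_of Hgr)[n [w [Hw eu]]] := Hu.
have w0 l : (l < n.+1)%N -> w l *m differential i = 0.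
  apply: (independent_pos Hgr Hind (n := n.+1)
    (g := fun l => w l *m differential i)) => [a|]; first exact: M1h.
  by rewrite -mulmx_suml -eu.
(* The components of positive degree are syzygies, of degree one less; the
   component of degree 0 is zero. *)
pose w' l := if (l < n)%N then w l.+1 else 0.
have /choice[v Hv] : forall l, exists v : 'rV[S]_(res_rank betti i.+2),
    hrow l v /\ w' l = v *m differential i.+1.
  move=> l; have /((differentialS i).1)[v Hv ev] :
      syzygy gr (fun r => row r (differential i)) l (w' l).
    rewrite /w'; case: ifP => [ln|_]; last first.
      by split; [exact: hrow_0|exact: lincomb0].
    by split; [exact: Hw|rewrite lincomb_rows; apply: w0].
  by exists v; split=> //; rewrite ev lincomb_rows.
exists (\sum_(l < n) v l).
  move=> j; rewrite summxE; apply: sum_of_sum => // l.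
  by apply: sum_of_one => //; case: (Hv l) => /(_ j) H _; exact: H.
rewrite eu big_ord_recl (differential_inj (Hw 0%N) (w0 0%N isT)) add0r.
rewrite mulmx_suml.
by apply: eq_bigr => l _; case: (Hv l) => _ <-; rewrite /w' ltn_ord.
Qed.

End Resolution.

Lemma koszul_of_linear : koszul (sum_of gr) gr.
Proof.
split; first exact: standard_graded_of_linear.
have [c [G [fG lG]]] := linear_modP Hgr Hlin; pose G0 := \matrix_j G j.
have eG : (fun r => row r G0) = G by apply/funext => r; rewrite rowK.
exists (betti G0), (differential G0).
by apply: linear_resolution_differential; rewrite /linear_syzygies eG.
Qed.

End KoszulOfLinear.

(** * The Rees product *)

Section ReesProductOfKoszul.
Variables (k : fieldType) (d e : nat).
Notation SA := {mpoly k[d]}.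
Notation SB := {mpoly k[e]}.
Notation SC := {mpoly k[d + e]}.

Lemma ideal_exp_graded (S : comAlgType k) (gr : nat -> set S) i f :
  graded_ring gr ->
  ideal_exp (sum_of gr) (irrelevant_ideal gr) i f ->
  sum_of (fun l => gr (i + l)%N) f.
Proof.
move=> Hgr.
have sum j := @family_sum_sum k S (fun l => gr (j + l)%N)
  (fun l => gr_0 Hgr (j + l)) (fun l => @gr_add k S gr Hgr (j + l)).
elim: i f => [//|i IH] f [n [g [h [Hg Hh ->]]]]; apply: (sum) => a.
have [m [x [Hx ->]]] := Hg a; have [m' [y [Hy ->]]] := IH _ (Hh a).
rewrite mulr_suml; apply: (sum) => b; rewrite mulr_sumr; apply: (sum) => c.
apply: (@family_sum_one k S (fun l => gr (i.+1 + l)%N)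
  (fun l => gr_0 Hgr (i.+1 + l)) (fun l => @gr_add k S gr Hgr (i.+1 + l))
  (b + c)%N).
have := gr_mul Hgr (Hx b) (Hy c).
by rewrite !addSn addnCA.
Qed.

(** Elements of degree i + 1 + l are combinations of generators of degree 1 with
    coefficients of degree i + l. *)
Lemma graded_ideal_exp (S : comAlgType k) (gr : nat -> set S) i l f :
  graded_ring gr -> linear_mod gr (@positive_rows k S gr 1) ->
  gr (i + l)%N f -> ideal_exp (sum_of gr) (irrelevant_ideal gr) i f.
Proof.
move=> Hgr Hlin; have [c [G [fG _]]] := Hlin 1%N.
elim: i f => [|i IH] f Hf; first exact: sum_of_one Hf.
have /(fG.1)[v Hv /rowP/(_ 0)] : positive_rows gr (i + l) (f%:M : 'rV[S]_1).
  by move=> j; rewrite (ord1 j) mxE eqxx mulr1n.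
rewrite mxE eqxx mulr1n /lincomb summxE => ->.
exists c, (fun j => G j 0 0), (fun j => v 0 j); split=> [j|j|].
- exists 1%N, (fun a => if a is 0 then G j 0 0 else 0); split=> [[|a]|].
  + exact: (free_gens_in Hgr j fG 0).
  + exact: gr_0.
  + by rewrite big_ord1.
- exact: IH (Hv j).
by apply: eq_bigr => j _; rewrite mxE mulrC.
Qed.

Lemma tensor_pair_span (V : set SA) (W : set SB) h :
  (forall (c : k) a, V a -> V (c *: a)) ->
  tensor V W h <-> pair_span (@prod_lr k d e) V W h.
Proof.
move=> VZ; split=> [H|Hh X [X0 XD] XP]; last first.
  move: h Hh; apply: pair_span_ind => // [w w' Hw Hw'|a b Ha Hb].
    by rewrite -[w]scale1r; apply: XD.
  by apply: XP; exists a => //; exists b.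
apply: H => [|_ [a Ha [b Hb <-]]]; last exact: pair_span1.
split=> [|c f g Hf Hg]; first exact: pair_span0.
apply: pair_spanD => //; move: f Hf; apply: pair_span_ind.
- by rewrite scaler0; apply: pair_span0.
- by move=> w w' Hw Hw'; rewrite scalerDr; apply: pair_spanD.
- by move=> a b Ha Hb; rewrite -prod_lrZl; apply: pair_span1 => //; apply: VZ.
Qed.

Variables (grA : nat -> set SA) (grB : nat -> set SB).
Hypotheses (HA : graded_ring grA) (HB : graded_ring grB).

Notation grC := (segre_gr grA (upto grB)).

Lemma segre_gr_upto j h :
  grC j h <-> upto (fun i => pair_span (@prod_lr k d e) (grA j) (grB i)) j h.
Proof.
have B0 i : grB i 0 := gr_0 HB i.
have BD i u v : grB i u -> grB i v -> grB i (u + v) by apply: gr_add.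
split=> [|[g [Hg ->]]].
  move: h; apply: pair_span_ind => [|w w' Hw Hw'|a b Ha [g [Hg ->]]].
  - by apply: upto_0 => i; apply: pair_span0.
  - by apply: upto_add => // i u v; apply: pair_spanD.
  exists (fun i => prod_lr a (g i)); split=> [i|]; first exact: pair_span1.
  by rewrite /prod_lr rmorph_sum mulr_sumr.
apply: pair_span_sum => i; move: (g i) (Hg i).
apply: pair_span_ind => [|w w' Hw Hw'|a b Ha Hb].
- exact: pair_span0.
- exact: pair_spanD.
apply: pair_span1 => //; apply: (upto_one B0 _ Hb).
by rewrite -ltnS.
Qed.

(** The degree in the first factor alone separates the components. *)
Lemma independent_segre_gr : independent grA -> independent grC.
Proof.
move=> Hind n h Hh h0 j lin; apply: coef_right_eq0 => m.
apply: (Hind n (fun l => coef_right m (h l))) => // [l|]; last first.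
  by rewrite -raddf_sum h0 raddf0.
move: (h l) (Hh l); apply: pair_span_ind => [|w w' Hw Hw'|a b Ha Hb].
- by rewrite raddf0; apply: gr_0.
- rewrite (raddfD (coef_right m)); exact: (gr_add HA Hw Hw').
by rewrite coef_right_prod; apply: gr_scale.
Qed.

End ReesProductOfKoszul.

Section ReesProductTheorem.
Variables (k : fieldType) (d e : nat) (L : set 'X_{1..d}) (G : set 'X_{1..e}).
Hypothesis kL : koszul (semigroup_ring k L) (semigroup_ring_gr k L).
Hypothesis kG : koszul (semigroup_ring k G) (semigroup_ring_gr k G).

Notation grA := (semigroup_ring_gr k L).
Notation grB := (semigroup_ring_gr k G).
Notation grC := (segre_gr grA (upto grB)).

Let HA : graded_ring grA := koszul_graded_ring kL.
Let HB : graded_ring grB := koszul_graded_ring kG.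
Let HC : graded_ring grC := graded_segre_gr HA (graded_upto HB).

Lemma rees_product_grE : rees_product_gr k L G = grC.
Proof.
apply/funext => j; apply/predeqP => h; rewrite segre_gr_upto //.
have eT i : tensor (grA j) (grB i) = pair_span (@prod_lr k d e) (grA j) (grB i).
  by apply/predeqP => f; rewrite tensor_pair_span // => c a; apply: gr_scale.
by split=> -[g [Hg ->]]; exists g; split=> // i; have := Hg i; rewrite eT.
Qed.

(** Both sides are the sum of the A_j (x) B_i with i <= j, organised by i on the
    left and by j on the right. *)
Lemma rees_productE : rees_product k L G = sum_of grC.
Proof.
have SA : semigroup_ring k L = sum_of grA by case: kL => -[].
have eT i : tensor (ideal_exp (sum_of grA) (irrelevant_ideal grA) i) (grB i) =
    pair_span (@prod_lr k d e)
      (ideal_exp (sum_of grA) (irrelevant_ideal grA) i) (grB i).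
  apply/predeqP => f; apply: tensor_pair_span => c a.
  case: i => [|i]; first exact: sum_of_scale.
  move=> [n [g [h [Hg Hh ->]]]]; exists n, (fun j => c *: g j), h; split=> //.
    move=> j; have [m [x [Hx ->]]] := Hg j; exists m, (fun l => c *: x l).
    by split=> [l|]; [exact: (gr_scale HA c (Hx l))|rewrite scaler_sumr].
  by rewrite scaler_sumr; apply: eq_bigr => j _; rewrite scalerAl.
have kA := koszul_linear kL.
have B0 i : grB i 0 := gr_0 HB i.
pose T i := pair_span (@prod_lr k d e)
  (ideal_exp (sum_of grA) (irrelevant_ideal grA) i) (grB i).
have -> : rees_product k L G = sum_of T.
  by rewrite /rees_product SA; congr sum_of; apply/funext => i; apply: eT.
apply/predeqP => h; split=> [[n [g [Hg ->]]]|[n [g [Hg ->]]]].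
  apply: (sum_of_sum HC) => i; move: (g i) (Hg i).
  apply: pair_span_ind => [|w w'|a b /(ideal_exp_graded HA)[m [x [Hx ->]]] Hb].
  - exact: (sum_of_one HC (gr_0 HC 0)).
  - exact: (sum_of_add HC).
  rewrite /prod_lr rmorph_sum mulr_suml; apply: (sum_of_sum HC) => l.
  apply: (sum_of_one HC (i := (i + l)%N)); apply: pair_span1 => //.
  exact: (upto_one B0 (leq_addr _ _) Hb).
have T0 i : T i 0 by apply: pair_span0.
have TD i u v : T i u -> T i v -> T i (u + v) by apply: pair_spanD.
apply: (family_sum_sum T0 TD) => j; move: (g j) (Hg j).
apply: pair_span_ind => [|w w'|a b Ha [x [Hx ->]]].
- exact: (family_sum_one T0 TD (T0 0%N)).
- exact: (family_sum_add T0 TD).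
rewrite /prod_lr rmorph_sum mulr_sumr; apply: (family_sum_sum T0 TD) => i.
have ij : (i <= j)%N by rewrite -ltnS.
apply: (family_sum_one T0 TD (i := i)); apply: pair_span1 => //.
by apply: (graded_ideal_exp (l := (j - i)%N)) => //; rewrite subnKC.
Qed.

Lemma koszul_rees_product : koszul (rees_product k L G) (rees_product_gr k L G).
Proof.
rewrite rees_productE rees_product_grE; apply: (koszul_of_linear HC).
  exact: (independent_segre_gr HA (koszul_independent kL)).
apply: (linear_segre_positive HA (graded_upto HB) (koszul_linear kL)).
exact: (linear_rees_positive HB (koszul_independent kG) (koszul_linear kG)).
Qed.

End ReesProductTheorem.

Theorem corollary4 (R : realType) (k : fieldType) (d e : nat)
    (Lambda : set 'X_{1..d}) (Gamma : set 'X_{1..e})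
    (affine_Lambda : affine_semigroup R Lambda)
    (affine_Gamma : affine_semigroup R Gamma)
    (homogeneous_Lambda : homogeneous R Lambda)
    (homogeneous_Gamma : homogeneous R Gamma)
    (koszul_Lambda :
       koszul (semigroup_ring k Lambda) (semigroup_ring_gr k Lambda))
    (koszul_Gamma :
       koszul (semigroup_ring k Gamma) (semigroup_ring_gr k Gamma)) :
  koszul (rees_product k Lambda Gamma) (rees_product_gr k Lambda Gamma).
Proof. exact: koszul_rees_product. Qed.
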